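(* Let $\alpha\ge-1/2$ and $\nu,\mu\in\mathbb{R}$. Let $f:\mathbb{R}_+\to\mathbb{C}$ be such that $t^\nu f(t)\in L^1(0,1)$ and $$\int_1^\infty t^{\nu-\alpha-1/2}\,|df(t)|<\infty\quad\text{and}\quad M^{\nu-\alpha-1/2}|f(M)|\to0\ \text{ as }M\to\infty.$$ Then $\mathcal{L}^{\alpha}_{\nu,\mu}f(r)$ converges for every $r>0$. Moreover, for any $\varepsilon>0$: 1. if $\mu+\nu-\alpha-3/2>0$, the convergence is uniform on the interval $[0,\varepsilon]$; 2. if $\mu+\nu-\alpha-3/2<0$, the convergence is uniform on the interval $[\varepsilon,\infty)$; 3. if $\mu+\nu-\alpha-3/2=0$, the convergence is uniform on $\mathbb{R}_+$.
   Context: $\mathbb{R}_+=[0,\infty)$. For $\alpha\ge-1/2$, $j_\alpha(z)=\Gamma(\alpha+1)(z/2)^{-\alpha}J_\alpha(z)$ is the normalized Bessel function, where $J_\alpha$ is the Bessel function of the first kind of order $\alpha$ (so $j_\alpha(0)=1$). Standing assumption: $f:\mathbb{R}_+\to\mathbb{C}$ is locally of bounded variation and locally integrable on $(0,\infty)$. Integrals against $|df(t)|$ are Stieltjes integrals with respect to the total variation of $f$. The transform is $\mathcal{L}^{\alpha}_{\nu,\mu}f(r)=r^\mu\int_0^\infty (rt)^\nu f(t)j_\alpha(rt)\,dt$, where $\int_0^\infty=\lim_{N\to\infty}\int_0^N$ (convergence at $r$ means that this limit exists and is finite) and $r^\mu(rt)^\nu$ is read as $r^{\mu+\nu}t^\nu$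 (at $r=0$ the factor $r^{\mu+\nu}$ is $1$ if $\mu+\nu=0$, $0$ if $\mu+\nu>0$, and undefined if $\mu+\nu<0$). It converges uniformly on a set $E\subset\mathbb{R}_+$ if the partial integrals $r^{\mu}\int_0^N (rt)^\nu f(t)j_\alpha(rt)\,dt$ converge uniformly in $r\in E$ as $N\to\infty$, equivalently $r^{\mu}\int_M^N (rt)^\nu f(t)j_\alpha(rt)\,dt\to0$ uniformly in $r\in E$ as $N>M\to\infty$. *)

(* Defs.v *)
From HB Require Import structures.
From mathcomp Require Import all_boot all_order all_algebra.
From mathcomp Require Import complex.
From mathcomp Require Import all_classical all_reals all_analysis.

Set Implicit Arguments.
Unset Strict Implicit.
Unset Printing Implicit Defensive.

Import Order.TTheory GRing.Theory Num.Theory numFieldNormedType.Exports.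
Import Normc.

Local Open Scope classical_set_scope.
Local Open Scope ring_scope.
Local Open Scope complex_scope.

Local Notation Re := complex.Re.
Local Notation Im := complex.Im.

(* A function on [0, +oo[ with complex values is represented by a total
   function f : R -> R[i]; its values at negative reals are never used.
   The alias R[i]^o is R[i] with its topology of normed module over itself. *)

Section bessel.
Context {R : realType}.
Implicit Types (alpha x z : R) (m : nat).

(* Euler's integral, meaningful for 0 < x, the only case needed below since
   alpha + 1 >= 1 / 2. *)
Definition Gamma x : R :=
  \int[lebesgue_measure]_(t in `]0, +oo[) (t `^ (x - 1) * expR (- t)).

Definition besselJ_term alpha z m : R :=
  (- 1) ^+ m / (m`!%:R * Gamma (m%:R + alpha + 1))
  * (z / 2) `^ ((2 * m)%:R + alpha).

(* Bessel function of the first kind, for 0 < z. *)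
Definition besselJ alpha z : R := limn (series (besselJ_term alpha z)).

(* For 0 <= z. The value at 0 is the one given by continuity; the formula
   itself is not usable there because 0 `^ p = 0 for p != 0. *)
Definition normalized_bessel alpha z : R :=
  if z == 0 then 1
  else Gamma (alpha + 1) * (z / 2) `^ (- alpha) * besselJ alpha z.

End bessel.

Section complex_valued_functions.
Context {R : realType}.
Implicit Types (a b : R) (f : R -> R[i]) (D : set R) (s : seq R).

Definition cintegrable D f : Prop :=
  lebesgue_measure.-integrable D (EFin \o (fun t => Re (f t))) /\
  lebesgue_measure.-integrable D (EFin \o (fun t => Im (f t))).

Definition cintegral D f : R[i] :=
  (\int[lebesgue_measure]_(t in D) Re (f t))
  +i* (\int[lebesgue_measure]_(t in D) Im (f t)).

Definition clocally_integrable D f : Prop :=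
  locally_integrable D (fun t => Re (f t)) /\
  locally_integrable D (fun t => Im (f t)).

(* The next three definitions are the library's [variation], [variations] and
   [bounded_variation] (stated there for real functions) with the complex
   modulus instead of the absolute value. *)
Definition cvariation a b f s : R :=
  let F := f \o nth b (a :: s) in
  \sum_(0 <= n < size s) normc (F n.+1 - F n).

Definition cvariations a b f : set R :=
  [set cvariation a b f s | s in itv_partition a b].

Definition cbounded_variation a b f : Prop := has_ubound (cvariations a b f).

Definition locally_bounded_variation_pos f : Prop :=
  forall a b, 0 < a -> a <= b -> cbounded_variation a b f.

(* Real-valued; meaningful when f has bounded variation on [a, b]. *)
Definition ctotal_variation a b f : R := sup (cvariations a b f).

End complex_valued_functions.

Section stieltjes.
Context {R : realType}.
Implicit Types (a b I : R) (g V xi : R -> R) (f : R -> R[i]) (s : seq R).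

(* a :: s are the division points of [a, b] and t i is the tag of the i-th
   subinterval. *)
Definition stieltjes_sum g V a b s (t : nat -> R) : R :=
  let x := nth b (a :: s) in
  \sum_(0 <= i < size s) g (t i) * (V (x i.+1) - V (x i)).

(* I is the Riemann-Stieltjes integral of g with respect to V on [a, b]: the
   limit of the tagged sums when the mesh of the division tends to 0. *)
Definition is_stieltjes_integral g V a b I : Prop :=
  forall e : R, 0 < e -> exists2 d : R, 0 < d &
    forall s (t : nat -> R), itv_partition a b s ->
    (forall i, (i < size s)%N ->
       let x := nth b (a :: s) in
       x i <= t i <= x i.+1 /\ x i.+1 - x i < d) ->
    `|stieltjes_sum g V a b s t - I| < e.

(* \int_a^oo g(t) |df(t)| is finite, where |df(t)| is dV(t) with V(t) the total
   variation of f on [a, t], and \int_a^oo is the limit of \int_a^N. *)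
Definition finite_variation_integral g f a : Prop :=
  exists I : R -> R,
    (forall N, a <= N ->
       is_stieltjes_integral g (fun t => ctotal_variation a t f) a N (I N)) /\
    cvg (I N @[N --> +oo]).

End stieltjes.

Section hankel.
Context {R : realType}.
Implicit Types (alpha nu mu r N : R) (f : R -> R[i]) (E : set R).

(* r^mu \int_0^N (rt)^nu f(t) j_alpha(rt) dt, with r^mu (rt)^nu read as
   r^(mu + nu) t^nu. For r = 0, [powR] gives the factor r^(mu + nu) the value 1
   if mu + nu = 0 and 0 if mu + nu > 0; the remaining case, mu + nu < 0, is
   undefined in the mathematical text and [powR] returns the dummy value 0. *)
Definition hankel_partial alpha nu mu f N r : R[i]^o :=
  (r `^ (mu + nu))%:C *
  cintegral `]0, N]
    (fun t => (t `^ nu)%:C * f t * (normalized_bessel alpha (r * t))%:C).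

Definition hankel_converges alpha nu mu f r : Prop :=
  cvg (hankel_partial alpha nu mu f N r @[N --> +oo]).

Definition hankel_transform alpha nu mu f r : R[i]^o :=
  lim (hankel_partial alpha nu mu f N r @[N --> +oo]).

Definition hankel_converges_uniformly alpha nu mu f E : Prop :=
  {uniform E, hankel_partial alpha nu mu f N @[N --> +oo]
              --> hankel_transform alpha nu mu f}.

End hankel.

(* Main.v *)
(* With b = nu - alpha - 1/2, write t^nu f(t) j_alpha(rt) as
   h(t) t^(alpha + 1/2) j_alpha(rt) where h(t) = t^b f(t). The hypotheses make h
   of bounded variation near infinity with limit 0: the variation of h on [M, N]
   is at most 2 \int_M^N t^b |df(t)| + M^b |f(M)| + N^b |f(N)|, whatever the sign
   of b. The other factor has a bounded primitive: w(u) = u^(alpha + 1/2) j_alpha(u)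
   satisfies w'' = (c / u^2 - 1) w with c = alpha^2 - 1/4, an energy estimate bounds
   w and w' on [1, oo[, and \int w = - w' + c \int w / u^2. By scaling, the integral
   of t^(alpha + 1/2) j_alpha(rt) over any interval is O(r^(- alpha - 3/2)), so Abel
   summation bounds the integral over [M, N], multiplied by r^(mu + nu), by
   r^(mu + nu - alpha - 3/2) times a quantity independent of r that tends to 0. *)

Require Import Defs.
From HB Require Import structures.
From mathcomp Require Import all_boot all_order all_algebra.
From mathcomp Require Import complex.
From mathcomp Require Import all_classical all_reals all_analysis.
From mathcomp Require Import measurable_realfun.
From mathcomp Require Import ring lra.
Import Order.TTheory GRing.Theory Num.Theory numFieldNormedType.Exports.
Import Normc.
Local Open Scope classical_set_scope.
Local Open Scope ring_scope.
Local Open Scope complex_scope.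

(** * Entire power series *)

Section power_series.
Context {R : realType}.
Implicit Types (c : nat -> R) (x s : R).

(** This class gives an infinite radius of convergence and is stable under termwise differentiation,
    under x d/dx and under linear combinations. Differential equations between such series thus
    reduce to identities between coefficients. *)
Definition factorial_decay c :=
  exists A B : R, [/\ 0 <= A, 0 <= B & forall m, `|c m| <= A * (B ^+ m / m`!%:R)].

Definition psum c x : R := limn (pseries c x).

Lemma factorial_decay_diffs c :
  factorial_decay c -> factorial_decay (pseries_diffs c).
Proof.
move=> [A [B [A0 B0 cAB]]]; exists (A * B), B; split=> //; first exact: mulr_ge0.
move=> m; rewrite /pseries_diffs normrM ger0_norm//.
apply: (le_trans (ler_wpM2l _ (cAB m.+1))) => //.
rewrite factS natrM exprS invfM le_eqVlt; apply/orP; left; apply/eqP.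
have n0 : m.+1%:R != 0 :> R by rewrite pnatr_eq0.
have n1 : m`!%:R != 0 :> R by rewrite pnatr_eq0 -lt0n fact_gt0.
by field; rewrite n1 addrC natr1.
Qed.

Lemma is_cvg_pseries_decay c x : factorial_decay c -> cvgn (pseries c x).
Proof.
move=> [A [B [A0 B0 cAB]]]; apply: normed_cvg.
apply: (@series_le_cvg _ _ (fun m => A * exp_coeff (B * `|x|) m)) => [n|n|n|].
- exact: normr_ge0.
- by rewrite mulr_ge0// /exp_coeff/= mulr_ge0// exprn_ge0// mulr_ge0.
- rewrite /= normrM (le_trans (ler_wpM2r _ (cAB n)))// /exp_coeff/=.
  by rewrite normrX exprMn le_eqVlt; apply/orP; left; apply/eqP; ring.
- exact: is_cvg_seriesZ (is_cvg_series_exp_coeff (B * `|x|)).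
Qed.

Lemma is_derive_psum c x : factorial_decay c ->
  is_derive x 1 (psum c) (psum (pseries_diffs c) x).
Proof.
(* Termwise differentiation at [x] asks for convergence, at a point of larger modulus, of the series
   and of its first two derived series. *)
move=> dc; apply: (@pseries_snd_diffs _ c (`|x| + 1)).
- exact: is_cvg_pseries_decay.
- exact/is_cvg_pseries_decay/factorial_decay_diffs.
- exact/is_cvg_pseries_decay/factorial_decay_diffs/factorial_decay_diffs.
- by rewrite [ltRHS]ger0_norm ?addr_ge0// ltrDl.
Qed.

Lemma continuous_psum c : factorial_decay c -> continuous (psum c).
Proof.
move=> dc x; apply: differentiable_continuous; apply/derivable1_diffP.
by have [] := is_derive_psum c x dc.
Qed.

Lemma cvg_psum c x : factorial_decay c -> pseries c x @ \oo --> psum c x.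
Proof. exact: is_cvg_pseries_decay. Qed.

(** Termwise form of the operator x d/dx. The term of index 0 on the right vanishes, hence [n.+1]
    terms there for [n] on the left. *)
Lemma pseries_euler c x n :
  x * pseries (pseries_diffs c) x n = pseries (fun m => m%:R * c m) x n.+1.
Proof.
rewrite /pseries /series/= big_nat_recl//= mul0r mul0r add0r mulr_sumr.
by apply: eq_bigr => i _; rewrite /pseries_diffs exprS; ring.
Qed.

Lemma factorial_decay_euler c : factorial_decay c ->
  factorial_decay (fun m => m%:R * c m).
Proof.
(* The factor [m] is at most [2 ^ m], which doubling the base absorbs. *)
move=> [A [B [A0 B0 cAB]]]; exists (A), (2 * B); split => //.
  exact: mulr_ge0.
move=> m; rewrite normrM ger0_norm// (le_trans (ler_wpM2l _ (cAB m)))//.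
rewrite mulrCA ler_wpM2l// exprMn mulrA ler_wpM2r ?invr_ge0//.
rewrite ler_wpM2r ?exprn_ge0// -natrX ler_nat.
exact/ltnW/ltn_expl.
Qed.

Lemma psum_euler c x : factorial_decay c ->
  x * psum (pseries_diffs c) x = psum (fun m => m%:R * c m) x.
Proof.
move=> dc; have eu := factorial_decay_euler _ dc.
have := cvg_psum _ x eu; rewrite -cvg_shiftS => /cvg_lim <- //.
apply/esym/cvg_lim; first exact: Rhausdorff.
under eq_fun do rewrite -pseries_euler.
apply: cvgM; first exact: cvg_cst.
exact/cvg_psum/factorial_decay_diffs.
Qed.

Lemma factorial_decay_lincomb c d (a b : R) :
  factorial_decay c -> factorial_decay d ->
  factorial_decay (fun m => a * c m + b * d m).
Proof.
move=> [A1 [B1 [A10 B10 cAB]]] [A2 [B2 [A20 B20 dAB]]].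
exists (`|a| * A1 + `|b| * A2), (B1 + B2).
split=> [||m]; first by rewrite addr_ge0 ?mulr_ge0.
  exact: addr_ge0.
have le_pow (B : R) : 0 <= B -> B <= B1 + B2 ->
    B ^+ m / m`!%:R <= (B1 + B2) ^+ m / m`!%:R.
  by move=> B0 BB; rewrite ler_wpM2r ?invr_ge0// lerXn2r ?nnegrE ?addr_ge0.
rewrite (le_trans (ler_normD _ _))// mulrDl !normrM -!mulrA lerD//.
  by rewrite ler_wpM2l// (le_trans (cAB m))// ler_wpM2l// le_pow// lerDl.
by rewrite ler_wpM2l// (le_trans (dAB m))// ler_wpM2l// le_pow// lerDr.
Qed.

Lemma psum_lincomb c d (a b : R) x : factorial_decay c -> factorial_decay d ->
  a * psum c x + b * psum d x = psum (fun m => a * c m + b * d m) x.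
Proof.
move=> dc dd; apply/esym/cvg_lim; first exact: Rhausdorff.
have -> : pseries (fun m => a * c m + b * d m) x =
    (fun n => a * pseries c x n + b * pseries d x n).
  apply/funext => n; rewrite /pseries /series/= !mulr_sumr -big_split/=.
  by apply: eq_bigr => i _; ring.
by apply: cvgD; (apply: cvgM; [exact: cvg_cst|exact: cvg_psum]).
Qed.

End power_series.

(** * The Gamma function *)

Section continuous_integrals.
Context {R : realType}.
Notation mu := (@lebesgue_measure R).
Implicit Types (f F g : R -> R) (a b t : R).

Lemma is_derive_continuous f t (d : R) : is_derive t 1 f d -> {for t, continuous f}.
Proof.
by case=> df _; apply: differentiable_continuous; exact/derivable1_diffP.
Qed.

Lemma continuous_on_itv f a b :
  (forall t, a <= t <= b -> {for t, continuous f}) ->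
  {within `[a, b], continuous f}.
Proof.
move=> cf; apply: continuous_in_subspaceT => t.
by rewrite inE/= in_itv/=; exact: cf.
Qed.

Lemma integrable_continuous f a b :
  (forall t, a <= t <= b -> {for t, continuous f}) ->
  mu.-integrable `[a, b] (EFin \o f).
Proof.
move=> cf; apply: continuous_compact_integrable; first exact: segment_compact.
exact: continuous_on_itv.
Qed.

Lemma Rintegral_FTC2 F f a b : a <= b ->
  (forall t, a <= t <= b -> is_derive t 1 F (f t)) ->
  (forall t, a <= t <= b -> {for t, continuous f}) ->
  \int[mu]_(t in `[a, b]) f t = F b - F a.
Proof.
rewrite le_eqVlt => /predU1P[->|ab] dF cf.
  by rewrite set_itv1 Rintegral_set1 subrr.
have cF t : a <= t <= b -> {for t, continuous F}.
  by move=> /dF /is_derive_continuous.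
rewrite /Rintegral (@continuous_FTC2 _ f F)//.
- exact: continuous_on_itv.
- split.
  + move=> t; rewrite in_itv/= => /andP[at_ tb].
    by have [] := dF t; rewrite ?ltW.
  + by apply: cvg_at_right_filter; apply: cF; rewrite lexx ltW.
  + by apply: cvg_at_left_filter; apply: cF; rewrite lexx ltW.
- move=> t; rewrite in_itv/= => /andP[at_ tb]; rewrite derive1E.
  by have [] := dF t; rewrite ?ltW.
Qed.

End continuous_integrals.

(** * Euler's integral and its functional equation *)

Section gamma.
Context {R : realType}.
Notation mu := (@lebesgue_measure R).
Implicit Types (x t : R).

Let gam x t : R := t `^ (x - 1) * expR (- t).
(** Compact intervals exhausting []0, +oo[]; they stay away from 0, where the integrand is singular
    for [x < 1]. *)
Let K n : set R := `[n.+1%:R^-1, n.+1%:R].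

Lemma is_derive_powR_exp x t : 0 < t ->
  is_derive t 1 (fun t => t `^ x * expR (- t)) (x * gam x t - gam (x + 1) t).
Proof.
move=> t0; have ? := is_derive1_powR x t0.
apply: is_derive_eq; rewrite /gam addrK /GRing.scale/=.
by ring.
Qed.

Lemma continuous_gamma_integrand x t : 0 < t -> {for t, continuous (gam x)}.
Proof.
move=> t0; have := is_derive_powR_exp (x - 1) t t0.
exact: is_derive_continuous.
Qed.

(** For an integer [k >= x], one term of the exponential series gives n^(k+1) / (k+1)! <= e^n, so
    the sequence is at most (k+1)! / n. *)
Lemma cvg_powR_expRN x : 0 < x ->
  n.+1%:R `^ x * expR (- n.+1%:R) @[n --> \oo] --> (0 : R).
Proof.
move=> x0; have [k xk] : exists k : nat, x <= k%:R.
  by exists (Num.truncn x).+1; exact/ltW/truncnS_gt.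
have harm : (k.+1)`!%:R * harmonic n @[n --> \oo] --> (0 : R).
  rewrite -[X in _ --> X](mulr0 (k.+1)`!%:R).
  by apply: cvgM; [exact: cvg_cst|exact: cvg_harmonic].
apply: (squeeze_cvgr _ _ harm); last exact: (cvg_cst 0).
near=> n; have n0 : 0 < n.+1%:R :> R by [].
rewrite mulr_ge0 ?powR_ge0 ?expR_ge0//=.
rewrite (@le_trans _ _ (n.+1%:R ^+ k * expR (- n.+1%:R)))//.
  rewrite ler_wpM2r ?expR_ge0// -powR_mulrn//.
  by rewrite ler_powR// ler1n.
have kn : n.+1%:R ^+ k.+1 / (k.+1)`!%:R <= expR n.+1%:R :> R.
  by rewrite (le_trans _ (expR_ge1Dxn k (ltW n0)))// lerDr.
rewrite ler_pdivrMr ?ltr0n ?fact_gt0// mulrC in kn.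
rewrite expRN ler_pdivrMr ?expR_gt0// /harmonic/= mulrAC ler_pdivlMr//.
by rewrite -exprSr.
Unshelve. all: by end_near. Qed.

Lemma cvg_powR_invn x : 0 < x ->
  n.+1%:R^-1 `^ x * expR (- n.+1%:R^-1) @[n --> \oo] --> (0 : R).
Proof.
move=> x0.
have px : n.+1%:R^-1 `^ x @[n --> \oo] --> (0 : R).
  have /cvg_at_rightP := @powR_cvg0 R _ x0; apply.
  by split=> [n|]; [rewrite invr_gt0|exact: cvg_harmonic].
apply: (squeeze_cvgr _ (cvg_cst 0) px).
near=> n; rewrite mulr_ge0 ?powR_ge0 ?expR_ge0//=.
by rewrite ler_piMr ?powR_ge0// expR_le1 oppr_le0.
Unshelve. all: by end_near. Qed.

(** Monotone convergence for a nonnegative integrand; the limit is taken in the extended reals,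
    where it exists whether finite or not. *)
Lemma cvg_gamma_integral x :
  (\int[mu]_(t in K n) gam x t)%:E @[n --> \oo] -->
  (\int[mu]_(t in `]0%R, +oo[) (gam x t)%:E)%E.
Proof.
have Kpos n t : K n t -> 0 < t.
  by rewrite /K/= in_itv/= => /andP[+ _]; apply: lt_le_trans; rewrite invr_gt0.
have ig n : mu.-integrable (K n) (EFin \o gam x).
  apply: integrable_continuous => t tK; apply: continuous_gamma_integrand.
  by apply: (Kpos n); rewrite /K/= in_itv.
have -> : `]0%R, +oo[%classic = \bigcup_n K n.
  apply/seteqP; split=> [t/=|t [n _]]; last first.
    by move=> /Kpos t0; rewrite /= in_itv/= t0.
  rewrite in_itv/= andbT => t0.
  exists (maxn (Num.truncn t) (Num.truncn t^-1)) => //.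
  rewrite /K/= in_itv/= -[leRHS]invrK lef_pV2 ?posrE ?invr_gt0//.
  apply/andP; split; apply: ltW.
    rewrite (lt_le_trans (truncnS_gt _))// ler_nat ltnS leq_max leqnn orbT//.
  by rewrite (lt_le_trans (truncnS_gt _))// ler_nat ltnS leq_max leqnn.
have -> : (fun n => (\int[mu]_(t in K n) gam x t)%:E) =
    (fun n => \int[mu]_(t in K n) (gam x t)%:E)%E.
  by apply/funext => n; rewrite /Rintegral fineK//; apply: integrable_fin_num (ig n); exact: measurable_itv.
apply: ge0_nondecreasing_set_cvg_integral.
- apply/nondecreasing_seqP => n; rewrite subsetEset; apply: subset_itvScc.
    by rewrite bnd_simp lef_pV2 ?posrE// ler_nat.
  by rewrite bnd_simp ler_nat.
- by move=> n; exact: measurable_itv.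
- by move=> n; have /integrableP[] := ig n.
- by move=> n t /Kpos t0; rewrite lee_fin mulr_ge0 ?powR_ge0 ?expR_ge0.
Qed.

(* Integrating by parts on [1/n, n] and letting n go to infinity in the extended
   reals needs no a priori finiteness of the integrals. *)
Lemma GammaD1 x : 0 < x -> Gamma (x + 1) = x * Gamma x.
Proof.
move=> x0.
have Kpos n t : n.+1%:R^-1 <= t <= n.+1%:R -> 0 < t.
  by case/andP=> + _; apply: lt_le_trans; rewrite invr_gt0.
have Kle n : n.+1%:R^-1 <= n.+1%:R :> R.
  by rewrite (@le_trans _ _ 1)// ?invf_le1// ?ler1n// ?ltr0n//.
pose u n : R := n.+1%:R `^ x * expR (- n.+1%:R) -
                n.+1%:R^-1 `^ x * expR (- n.+1%:R^-1).
have parts n : \int[mu]_(t in K n) gam (x + 1) t =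
    x * (\int[mu]_(t in K n) gam x t) - u n.
  have ig y : mu.-integrable (K n) (EFin \o gam y).
    apply: integrable_continuous => t /Kpos; exact: continuous_gamma_integrand.
  have <- : \int[mu]_(t in K n) (x * gam x t - gam (x + 1) t) = u n.
    apply: (@Rintegral_FTC2 _ (fun t => t `^ x * expR (- t))) => //.
      by move=> t /Kpos; exact: is_derive_powR_exp.
    move=> t /Kpos t0; apply: cvgB; last exact: continuous_gamma_integrand.
    by apply: cvgM; [exact: cvg_cst|exact: continuous_gamma_integrand].
  have mK : measurable (K n) by exact: measurable_itv.
  rewrite RintegralB//; last first.
    apply: integrable_continuous => t /Kpos t0.
    by apply: cvgM; [exact: cvg_cst|exact: continuous_gamma_integrand].
  by rewrite RintegralZl//; ring.
have u0 : (u n)%:E @[n --> \oo] --> 0%E.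
  apply: cvg_EFin; first by near=> n.
  rewrite -[X in _ --> X](subrr (0 : R)).
  by apply: cvgB; [exact: cvg_powR_expRN|exact: cvg_powR_invn].
have cB := cvg_gamma_integral (x + 1).
have cA := cvg_gamma_integral x.
have cB' : (\int[mu]_(t in K n) gam (x + 1) t)%:E @[n --> \oo] -->
    (x%:E * (\int[mu]_(t in `]0%R, +oo[) (gam x t)%:E) - 0)%E.
  under eq_fun do rewrite parts EFinB EFinM.
  apply: cvgeB => //; first by rewrite fin_num_adde_defl.
  exact: cvgeZl.
have := cvg_unique _ cB cB'; rewrite sube0 /Gamma /Rintegral -/gam => ->//.
set A := (\int[_]_(_ in _) _)%E.
(* An infinite integral is read as the real number 0, and [x > 0] makes the integral for [x + 1]
   infinite as well, so both sides are then 0. *)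
case: A => [r| |]/=; first by [].
  by rewrite gt0_muley ?lte_fin//= mulr0.
by rewrite gt0_muleNy ?lte_fin//= mulr0.
Unshelve. all: by end_near. Qed.

End gamma.

(** * Bessel functions *)

Section monotonicity.
Context {R : realType}.
Implicit Types (f F : R -> R) (a b : R).

Lemma is_derive_le0 F f a b : a <= b ->
  (forall t, a <= t <= b -> is_derive t 1 F (f t)) ->
  (forall t, a <= t <= b -> f t <= 0) -> F b <= F a.
Proof.
move=> ab dF f0; have [t||t] := MVT_segment ab (f := F) (df := f).
- by rewrite in_itv/= => /andP[at_ tb]; apply: dF; rewrite !ltW.
- by apply: continuous_on_itv => t /dF /is_derive_continuous.
rewrite in_itv/= => /f0 ft Fab.
by rewrite -subr_le0 Fab mulr_le0_ge0// subr_ge0.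
Qed.

(* The energy [w1 ^ 2 + w ^ 2] grows by a factor at most [exp |k|], so [w] and
   [w1] are bounded; then [Om + w1] has the integrable derivative
   [k * w / u ^ 2]. *)
Lemma bounded_primitive_ode (k : R) (w w1 Om : R -> R) :
  (forall u : R, 1 <= u -> is_derive u 1 Om (w u)) ->
  (forall u : R, 1 <= u -> is_derive u 1 w (w1 u)) ->
  (forall u : R, 1 <= u -> is_derive u 1 w1 ((k / u ^+ 2 - 1) * w u)) ->
  exists C, forall u : R, 1 <= u -> `|Om u| <= C.
Proof.
move=> dOm dw dw1.
pose K : R := `|k|; have K0 : 0 <= K by exact: normr_ge0.
have kK : - K <= k <= K by rewrite -ler_norml.
pose E u := w1 u * w1 u + w u * w u.
have dinv (u : R) : 1 <= u -> is_derive u 1 (fun u : R => u^-1) (- u ^- 2).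
  move=> u1; have u0 : u != 0 by rewrite gt_eqF// (lt_le_trans _ u1).
  apply: (is_derive_eq (is_deriveV u0 (is_derive_id u 1))).
  by rewrite /GRing.scale/= mulr1.
have E0 (u : R) : 0 <= E u by rewrite addr_ge0 -?expr2 ?sqr_ge0.
have EK (u : R) : 1 <= u -> E u <= E 1 * expR K.
  move=> u1.
  (* Since E' = 2 k w w1 / u^2 is at most K E / u^2, the factor exp (K / u), with logarithmic
     derivative - K / u^2, makes the product nonincreasing. *)
  have : E u * expR (K * u^-1) <= E 1 * expR (K * 1^-1).
    apply: (is_derive_le0 (fun u => E u * expR (K * u^-1)) (fun u =>
        (2 * k * (w1 u * w u) - K * E u) * (u ^- 2 * expR (K * u^-1)))) => // t /andP[t1 _].
      have ? := dinv t t1; have ? := dw t t1; have ? := dw1 t t1.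
      have t0 : t != 0 by rewrite gt_eqF// (lt_le_trans _ t1).
      have dK : is_derive t 1 (fun u => expR (K * u^-1)) (expR (K * t^-1) * (K * - t ^- 2)).
        apply: (@is_derive1_comp _ expR (fun u => K * u^-1)).
      by apply: is_derive_eq; rewrite /GRing.scale/= /E; field.
    rewrite mulr_le0_ge0//; last by rewrite mulr_ge0 ?expR_ge0// invr_ge0 sqr_ge0.
    (* Minus a sum of squares, whose coefficients are nonnegative because [|k| = K]. *)
    have -> : 2 * k * (w1 t * w t) - K * E t =
        - ((K + k) / 2 * (w1 t - w t) ^+ 2 + (K - k) / 2 * (w1 t + w t) ^+ 2).
      by rewrite /E; field.
    rewrite oppr_le0 addr_ge0// mulr_ge0 ?sqr_ge0//; lra.
  rewrite invr1 mulr1; apply: le_trans.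
  rewrite ler_peMr// -expR0 ler_expR mulr_ge0// invr_ge0.
  by rewrite (le_trans _ u1).
have [B B0 wB] : exists2 B : R, 0 <= B & forall u : R, 1 <= u -> `|w u| <= B /\ `|w1 u| <= B.
  have D0 : 0 <= E 1 * expR K by rewrite mulr_ge0// expR_ge0.
  (* From x^2 <= D follows |x| <= 1 + D, which avoids a square root. *)
  exists (1 + E 1 * expR K) => [|u /EK Eu]; first by rewrite addr_ge0.
  have sq (x : R) : x ^+ 2 <= E 1 * expR K -> `|x| <= 1 + E 1 * expR K.
    rewrite -real_normK ?num_real//; move: (normr_ge0 x) D0.
    by move: (E 1 * _) (`|x|) => D y; nra.
  by split; apply: sq; apply: le_trans Eu; rewrite /E -!expr2 ?lerDl ?lerDr sqr_ge0.
pose G (u : R) := Om u + w1 u.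
have dG (u : R) : 1 <= u -> is_derive u 1 G (k / u ^+ 2 * w u).
  move=> u1; have ? := dOm u u1; have ? := dw1 u u1.
  by rewrite /G; apply: is_derive_eq; ring.
have GB (u : R) : 1 <= u -> `|G u - G 1| <= K * B.
  move=> u1; have u0 : 0 <= u^-1 by rewrite invr_ge0 (le_trans _ u1).
  have KB0 : 0 <= K * B by rewrite mulr_ge0.
  have kwB (t : R) : 1 <= t -> `|k * w t| <= K * B.
    by move=> t1; rewrite normrM ler_pM//; have [] := wB t t1.
  (* The derivative of G is at most K B / u^2 in modulus, so s G + K B / u is nonincreasing for both
     signs [s]; the two signs together bound |G u - G 1|. *)
  have side (s : R) : `|s| = 1 -> s * G u + K * B * u^-1 <= s * G 1 + K * B * 1^-1.
    move=> s1; apply: (is_derive_le0 (fun u => s * G u + K * B * u^-1)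
      (fun u => (s * (k * w u) - K * B) * u ^- 2)) => // t /andP[t1 _].
      have ? := dinv t t1; have ? := dG t t1.
      by apply: is_derive_eq; rewrite /GRing.scale/=; ring.
    rewrite mulr_le0_ge0 ?invr_ge0 ?sqr_ge0// subr_le0.
    by rewrite (le_trans (ler_norm _))// normrM s1 mul1r kwB.
  have KBu : 0 <= K * B * u^-1 by rewrite mulr_ge0.
  have := side 1 (normr1 _); have := side (- 1); rewrite normrN1 => /(_ erefl).
  by rewrite ler_norml invr1; move: KBu; lra.
exists (K * B + `|G 1| + B) => u u1.
have [_ w1B] := wB u u1.
have -> : Om u = (G u - G 1) + G 1 - w1 u by rewrite /G; ring.
by rewrite (le_trans (ler_normB _ _))// lerD// (le_trans (ler_normD _ _))// lerD// GB.
Qed.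

End monotonicity.

(** * The Bessel series, its differential equation and a bounded primitive *)

Section bessel_series.
Context {R : realType} {alpha : R}.
Hypothesis halpha : - (1 / 2) <= alpha.
Implicit Types (u z s : R) (m : nat).

(** Coefficients of (z/2)^(-alpha) J_alpha(z) as a power series in s = z^2 / 4. *)
Let c m : R := (- 1) ^+ m / (m`!%:R * Gamma (m%:R + alpha + 1)).
Let p : R := alpha + 1 / 2.

(** The functional equation of Gamma, in the form that yields Bessel's equation coefficient by
    coefficient. *)
Lemma besselc_rec m : c m.+1 * (m.+1%:R * (m.+1%:R + alpha)) = - c m.
Proof.
have ma0 : 0 < m%:R + alpha + 1 :> R by have := ler0n R m; move: halpha; lra.
rewrite /c (_ : m.+1%:R + alpha + 1 = m%:R + alpha + 1 + 1); last first.
  by rewrite -natr1; ring.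
rewrite GammaD1// factS natrM exprS.
have -> : m.+1%:R + alpha = m%:R + alpha + 1 by rewrite -natr1; ring.
rewrite !invfM mulN1r !mulNr; congr (- _).
have m0 : m.+1%:R != 0 :> R by rewrite pnatr_eq0.
transitivity ((- 1) ^+ m * (m`!%:R^-1 * (Gamma (m%:R + alpha + 1))^-1) *
  (m.+1%:R^-1 * m.+1%:R) *
  ((m%:R + alpha + 1)^-1 * (m%:R + alpha + 1))).
  by ring.
by rewrite !mulVf ?mulr1// gt_eqF.
Qed.

(** As [alpha >= - 1 / 2], the factor m + 1 + alpha of the recurrence is at least 1/2, so |c_(m+1)|
    <= 2 |c_m| / (m + 1); hence the constants [|c 0|] and 2. *)
Lemma besselc_decay : factorial_decay c.
Proof.
exists `|c 0|, 2; split=> //; elim=> [|m IH].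
  by rewrite expr0 fact0 divr1 mulr1.
have ma0 : 0 < m.+1%:R + alpha by rewrite -[m.+1%:R]natr1; have := ler0n R m; move: halpha; lra.
have m0 : 0 < m.+1%:R :> R by [].
have := congr1 Num.norm (besselc_rec m).
rewrite normrN normrM (ger0_norm (ltW (mulr_gt0 m0 ma0))) => e.
have ma2 : 1 <= 2 * (m.+1%:R + alpha).
  by rewrite -[m.+1%:R]natr1; have := ler0n R m; move: halpha; lra.
have cm : `|c m.+1| * m.+1%:R <= 2 * `|c m|.
  rewrite -e mulrCA ler_wpM2l//.
  by rewrite mulrCA -[leLHS]mulr1 ler_wpM2l// ltW.
rewrite -ler_pdivlMr// in cm; apply: (le_trans cm).
rewrite factS natrM exprS.
have -> : `|c 0| * (2 * 2 ^+ m / (m.+1%:R * m`!%:R)) =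
    2 * (`|c 0| * (2 ^+ m / m`!%:R)) / m.+1%:R.
  by rewrite invfM; ring.
by rewrite ler_wpM2r ?invr_ge0 ?ler0n// ler_wpM2l.
Qed.

Lemma normalized_besselE z : 0 < z ->
  normalized_bessel alpha z = Gamma (alpha + 1) * psum c (z ^+ 2 / 4).
Proof.
move=> z0; rewrite /normalized_bessel gt_eqF// -mulrA; congr (_ * _).
have z20 : 0 < z / 2 by rewrite divr_gt0.
have term m : besselJ_term alpha z m = (z / 2) `^ alpha * (c m * (z ^+ 2 / 4) ^+ m).
  rewrite /besselJ_term -/(c m) powRD ?(gt_eqF z20) ?implybT//.
  rewrite powR_mulrn ?ltW// exprM (_ : (z / 2) ^+ 2 = z ^+ 2 / 4); last by field.
  by ring.
have -> : besselJ alpha z = (z / 2) `^ alpha * psum c (z ^+ 2 / 4).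
  apply: cvg_lim; first exact: Rhausdorff.
  have -> : series (besselJ_term alpha z) =
      (fun n => (z / 2) `^ alpha * pseries c (z ^+ 2 / 4) n).
    apply/funext => n; rewrite /pseries /series/= mulr_sumr.
    by apply: eq_bigr => i _; exact: term.
  by apply: cvgM; [exact: cvg_cst|exact/cvg_psum/besselc_decay].
by rewrite mulrA -powRD ?addNr ?powRr0 ?mul1r// (gt_eqF z20) implybT.
Qed.

Let S s := psum c s.
Let S1 s := psum (pseries_diffs c) s.
Let S2 s := psum (pseries_diffs (pseries_diffs c)) s.

(** Bessel's equation in the variable s = u^2 / 4: the coefficient of s^m is (m + 1) (m + 1 + alpha)
    c_(m+1) + c_m, which the recurrence makes 0. *)
Lemma bessel_series_ode s : s * S2 s + (alpha + 1) * S1 s + S s = 0.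
Proof.
have d0 := besselc_decay.
have d1 := factorial_decay_diffs _ d0.
have de := factorial_decay_euler _ d1.
rewrite psum_euler// -[X in X + _ + _]mul1r psum_lincomb//.
have dl := factorial_decay_lincomb _ _ 1 (alpha + 1) de d1.
rewrite -[X in X + _]mul1r -[X in _ + X]mul1r psum_lincomb//.
have -> : (fun m => 1 * (1 * (m%:R * pseries_diffs c m) +
    (alpha + 1) * pseries_diffs c m) + 1 * c m) = (fun=> 0).
  apply/funext => m; rewrite /pseries_diffs.
  by rewrite -[c m]opprK -besselc_rec -natr1; ring.
apply: cvg_lim; first exact: Rhausdorff.
have -> : pseries (fun=> 0) s = fun=> 0 :> R.
  by apply/funext => n; rewrite /pseries /series/= big1// => i _; rewrite mul0r.
exact: cvg_cst.
Qed.

(** Integrating u^(p + 2m) divides by p + 2m + 1 = 2 (m + (p + 1) / 2). So u^(p+1) / 2 times T(u^2 /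
    4) is the termwise primitive of u^p S(u^2 / 4). *)
Let T s := psum (fun m => c m / (m%:R + (p + 1) / 2)) s.

Let T1 s := psum (pseries_diffs (fun m => c m / (m%:R + (p + 1) / 2))) s.

Lemma decay_T : factorial_decay (fun m => c m / (m%:R + (p + 1) / 2)).
Proof.
have [A [B [A0 B0 cAB]]] := besselc_decay.
exists (2 * A), B; split=> [||m]//; first exact: mulr_ge0.
have d0 : 1 / 2 <= m%:R + (p + 1) / 2 by rewrite /p; have := ler0n R m; move: halpha; lra.
rewrite normrM normfV (ger0_norm (le_trans _ d0))//.
have dp : 0 < m%:R + (p + 1) / 2 by rewrite (lt_le_trans _ d0).
rewrite ler_pdivrMr// (le_trans (cAB m))// -[2 * A * _]mulrA.
have : 0 <= A * (B ^+ m / m`!%:R) by rewrite mulr_ge0// divr_ge0 ?exprn_ge0.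
by move: (A * _) d0 => X d0 X0; nra.
Qed.

(** The operator s d/ds + (p + 1) / 2 multiplies the m-th coefficient by m + (p + 1) / 2 and so
    undoes the division in [T]. This is what makes [w] the derivative of [Om]. *)
Lemma T_ode s : s * T1 s + (p + 1) / 2 * T s = S s.
Proof.
rewrite psum_euler; last exact: decay_T.
rewrite -[X in X + _]mul1r psum_lincomb; last 2 first.
- exact/factorial_decay_euler/decay_T.
- exact: decay_T.
congr (psum _ s); apply/funext => m; field.
by apply: lt0r_neq0; rewrite /p; have := ler0n R m; move: halpha; lra.
Qed.

(** Up to the factor [Gamma (alpha + 1)], [w u] is u^(alpha + 1/2) j_alpha(u); [w1] is its
    derivative and [Om] a primitive. *)
Let w u := u `^ p * S (u ^+ 2 / 4).
Let w1 u := p * u `^ (p - 1) * S (u ^+ 2 / 4)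
            + u `^ (p + 1) / 2 * S1 (u ^+ 2 / 4).
Let Om u := u `^ (p + 1) / 2 * T (u ^+ 2 / 4).

Lemma is_derive_psum_sqr (d : nat -> R) u : factorial_decay d ->
  is_derive u 1 (fun u => psum d (u ^+ 2 / 4))
    (u / 2 * psum (pseries_diffs d) (u ^+ 2 / 4)).
Proof.
move=> dd; have dp := is_derive_psum d (u ^+ 2 / 4) dd.
have dq : is_derive u 1 (fun u : R => u ^+ 2 / 4) (u / 2).
  by apply: is_derive_eq; rewrite /GRing.scale/=; field.
by rewrite mulrC; exact: (@is_derive1_comp _ (psum d) (fun u => u ^+ 2 / 4)).
Qed.

Lemma is_derive_Om u : 0 < u -> is_derive u 1 Om (w u).
Proof.
move=> u0; have ? := is_derive1_powR (p + 1) u0.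
have ? := is_derive_psum_sqr _ u decay_T.
apply: is_derive_eq.
rewrite /GRing.scale/= /w -T_ode addrK powRD ?(gt_eqF u0) ?implybT//.
by rewrite powRr1 ?ltW// /T /T1; field.
Qed.

Lemma is_derive_w u : 0 < u -> is_derive u 1 w (w1 u).
Proof.
move=> u0; have ? := is_derive1_powR p u0.
have ? := is_derive_psum_sqr _ u besselc_decay.
apply: is_derive_eq.
have e : u `^ (p + 1) = u `^ p * u.
  by rewrite powRD ?(gt_eqF u0) ?implybT// powRr1 ?ltW.
by rewrite /GRing.scale/= /w1 e /S /S1; field.
Qed.

(** The exponent p = alpha + 1/2 is the one that removes the first-order term from Bessel's
    equation; p (p - 1) = alpha^2 - 1/4. *)
Lemma is_derive_w1 u : 0 < u ->
  is_derive u 1 w1 ((p * (p - 1) / u ^+ 2 - 1) * w u).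
Proof.
move=> u0; have ? := is_derive1_powR (p - 1) u0.
have ? := is_derive1_powR (p + 1) u0.
have ? := is_derive_psum_sqr _ u besselc_decay.
have ? := is_derive_psum_sqr _ u (factorial_decay_diffs _ besselc_decay).
apply: is_derive_eq.
(* All real powers are expressed through u^(p - 2), so that only polynomial algebra in [u] remains
   once the equation has eliminated the second derivative. *)
have e2 : p - 1 - 1 = p - 2 by ring.
have up1 : u `^ (p + 1) = u `^ (p - 2) * u ^+ 3.
  rewrite -powR_mulrn ?ltW// -powRD ?(gt_eqF u0) ?implybT//.
  by congr powR; ring.
have up : u `^ p = u `^ (p - 2) * u ^+ 2.
  rewrite -powR_mulrn ?ltW// -powRD ?(gt_eqF u0) ?implybT//.
  by congr powR; ring.
have upm : u `^ (p - 1) = u `^ (p - 2) * u.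
  rewrite -{3}(powRr1 (ltW u0)) -powRD ?(gt_eqF u0) ?implybT//.
  by congr powR; ring.
have := bessel_series_ode (u ^+ 2 / 4).
rewrite /GRing.scale/= /w addrK e2 up1 up upm /S /S1 /S2.
set q := u `^ (p - 2); set s0 := psum _ _; set s1 := psum _ _; set s2 := psum _ _.
rewrite /p => ode.
have -> : s2 = - (u ^+ 2 / 4 * s0 + (alpha + 1) * s1) by lra.
by field; rewrite gt_eqF.
Qed.

(** The energy estimate covers [1, oo[. On ]0, 1] the factor u^(p+1) / 2 is at most 1 and the
    continuous [T] is bounded on [0, 1], which contains u^2 / 4. *)
Lemma bounded_bessel_primitive : exists C, forall u, 0 < u -> `|Om u| <= C.
Proof.
have [C1 OmC1] : exists C, forall u : R, 1 <= u -> `|Om u| <= C.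
  have pos u : 1 <= u -> 0 < u by apply: lt_le_trans.
  apply: (bounded_primitive_ode (p * (p - 1)) w w1) => u /pos.
  - exact: is_derive_Om.
  - exact: is_derive_w.
  - exact: is_derive_w1.
have [s s01 Ts] : exists2 s, s \in `[0, 1] &
    forall t, t \in `[0, 1] -> `|T t| <= `|T s|.
  apply: EVT_max => //; apply: continuous_on_itv => t _.
  by apply: continuous_comp; [exact/continuous_psum/decay_T|exact: norm_continuous].
exists (Num.max C1 `|T s|) => u u0; rewrite le_max.
have [u1|/ltW u1] := leP 1 u; first by rewrite OmC1.
apply/orP; right; rewrite /Om normrM -[leRHS]mul1r ler_pM//.
  have u1' : u `^ (p + 1) <= 1.
    rewrite -[leRHS](powRr0 u) ger_powR ?u0//.
    by rewrite /p; move: halpha; lra.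
  by rewrite ger0_norm ?divr_ge0 ?powR_ge0//; lra.
apply: Ts; rewrite in_itv/=; apply/andP; split; nra.
Qed.

(** All that the sequel uses about Bessel functions. The function [j] is continuous on the whole
    line and replaces [normalized_bessel alpha] under the integral sign. *)
Lemma normalized_bessel_primitive : exists (j Om : R -> R) (C : R),
  [/\ continuous j,
      forall u, 0 < u -> normalized_bessel alpha u = j u,
      forall u, 0 < u -> is_derive u 1 Om (u `^ (alpha + 1 / 2) * j u) &
      forall u, 0 < u -> `|Om u| <= C].
Proof.
have [C OmC] := bounded_bessel_primitive.
pose G := Gamma (alpha + 1).
exists (fun u => G * S (u ^+ 2 / 4)), (fun u => G * Om u), (`|G| * C).
split=> u.
- apply: cvgM; first exact: cvg_cst.
  apply: (is_derive_continuous (fun u => S (u ^+ 2 / 4)) u).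
  exact/is_derive_psum_sqr/besselc_decay.
- exact: normalized_besselE.
- move=> u0; have ? := is_derive_Om u u0.
  by apply: is_derive_eq; rewrite /GRing.scale/= /w; ring.
- by move=> u0; rewrite normrM ler_wpM2l// OmC.
Qed.

End bessel_series.

(** * Summation by parts and Stieltjes sums *)

Section sums.
Context {R : realType}.
Implicit Types (g h f V P x : nat -> R) (n : nat).

(** Summation by parts against P - P 0, which vanishes at index 0 and so leaves a boundary term at
    [n] only. *)
Lemma sum_abel h P n (K : R) : (forall i, `|P i - P 0| <= K) ->
  `|\sum_(0 <= i < n) h i * (P i.+1 - P i)| <=
  K * (`|h n| + \sum_(0 <= i < n) `|h i.+1 - h i|).
Proof.
move=> PK; have -> : \sum_(0 <= i < n) h i * (P i.+1 - P i) =
    h n * (P n - P 0) - \sum_(0 <= i < n) (h i.+1 - h i) * (P i.+1 - P 0).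
  elim: n => [|n IH]; first by rewrite !big_geq// !subrr mulr0 subr0.
  by rewrite !big_nat_recr//= IH; ring.
rewrite (le_trans (ler_normB _ _))// [leRHS]mulrDr lerD//.
  by rewrite normrM mulrC ler_wpM2r.
rewrite (le_trans (ler_norm_sum _ _ _))// mulr_sumr ler_sum// => i _.
by rewrite normrM mulrC ler_wpM2r.
Qed.

(** The sign [sg] says whether [g] increases or decreases. The product rule splits an increment of g
    f into g dV, a left-tagged Stieltjes term, and |dg| |f|. A second summation by parts, with a
    majorant of |f| built from V, turns the latter into the same Stieltjes sum and boundary
    terms. *)
Lemma sum_variation_mul g f V n (sg : R) :
  (forall i, 0 <= g i) ->
  (forall i, `|g i.+1 - g i| = sg * (g i.+1 - g i)) -> sg = 1 \/ sg = - 1 ->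
  (forall i, (i < n)%N -> `|f i.+1 - f i| <= V i.+1 - V i) ->
  \sum_(0 <= i < n) `|g i.+1 * f i.+1 - g i * f i| <=
  2 * (\sum_(0 <= i < n) g i * (V i.+1 - V i)) + g 0 * `|f 0| + g n * `|f n|.
Proof.
move=> g0 dg sg1 fV.
have split_term i : (i < n)%N ->
    `|g i.+1 * f i.+1 - g i * f i| <=
    g i * (V i.+1 - V i) + sg * (g i.+1 - g i) * `|f i.+1|.
  move=> ni; have -> : g i.+1 * f i.+1 - g i * f i =
    g i * (f i.+1 - f i) + (g i.+1 - g i) * f i.+1 by ring.
  rewrite (le_trans (ler_normD _ _))// !normrM dg lerD2r (ger0_norm (g0 i)).
  by rewrite ler_wpM2l// fV.
have sumV k l : (k <= l)%N -> (l <= n)%N -> `|f l - f k| <= V l - V k.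
  elim: l => [|l IH]; first by rewrite leqn0 => /eqP -> _; rewrite !subrr normr0.
  rewrite leq_eqVlt ltnS => /predU1P[-> _|kl ln]; first by rewrite !subrr normr0.
  have := IH kl (ltnW ln); have := fV l ln.
  by have := ler_distD (f l) (f l.+1) (f k); lra.
pose A := \sum_(0 <= i < n) g i * (V i.+1 - V i).
have byparts (G : nat -> R) m :
    \sum_(0 <= i < m) sg * (g i.+1 - g i) * G i.+1 =
    sg * (g m * G m - g 0 * G 0) + sg * \sum_(0 <= i < m) g i * (G i - G i.+1).
  elim: m => [|m IH]; first by rewrite !big_geq// subrr !mulr0 addr0.
  by rewrite !big_nat_recr//= IH; ring.
(* The increments of the majorant [G] are those of V up to the sign - sg, so the summation by parts
   returns exactly the sum [A]. *)
have bound (G : nat -> R) : (forall i, (i <= n)%N -> `|f i| <= G i) ->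
    (forall i, sg * (G i - G i.+1) = V i.+1 - V i) ->
    \sum_(0 <= i < n) `|g i.+1 * f i.+1 - g i * f i| <=
    2 * A + sg * (g n * G n - g 0 * G 0).
  move=> fG dG.
  apply: (@le_trans _ _ (A + \sum_(0 <= i < n) sg * (g i.+1 - g i) * G i.+1)).
    rewrite -big_split/=; apply: ler_sum_nat => i /andP[_ ni].
    rewrite (le_trans (split_term i ni))// lerD2l ler_wpM2l ?fG//.
    by rewrite -dg.
  rewrite byparts mulr_sumr (_ : \sum_(0 <= i < n) _ = A); first by lra.
  by apply: eq_bigr => i _; rewrite mulrCA dG.
rewrite -/A; case: sg1 => sgE.
  (* For increasing g the majorant is anchored at the right end, and the boundary term at 0 is
     negative. *)
  have := bound (fun i => `|f n| + (V n - V i)) => /(_ _ _)/le_trans; apply.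
  - move=> i ni; have := sumV i n ni (leqnn n).
    by have := ler_distD (f n) (f i) 0; rewrite !subr0 (distrC (f i)); lra.
  - by move=> i; rewrite sgE; ring.
  have := sumV 0 n (leq0n n) (leqnn n); have := normr_ge0 (f n - f 0).
  have := g0 0; have := g0 n; have := normr_ge0 (f n); have := normr_ge0 (f 0).
  rewrite sgE subrr addr0 mul1r => *.
  have ? : 0 <= g 0 * (`|f n| + (V n - V 0)) by rewrite mulr_ge0//; lra.
  have ? : 0 <= g 0 * `|f 0| by rewrite mulr_ge0.
  lra.
(* For decreasing g it is anchored at the left end, and the boundary term at [n] is negative. *)
have := bound (fun i => `|f 0| + (V i - V 0)) => /(_ _ _)/le_trans; apply.
- move=> i ni; have := sumV 0 i (leq0n i) ni.
  by have := ler_distD (f 0) (f i) 0; rewrite !subr0; lra.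
- by move=> i; rewrite sgE; ring.
have := sumV 0 n (leq0n n) (leqnn n); have := normr_ge0 (f n - f 0).
have := g0 0; have := g0 n; have := normr_ge0 (f n); have := normr_ge0 (f 0).
rewrite sgE subrr addr0 => *.
have ? : 0 <= g n * (`|f 0| + (V n - V 0)) by rewrite mulr_ge0//; lra.
have ? : 0 <= g n * `|f n| by rewrite mulr_ge0.
lra.
Qed.

End sums.

Section stieltjes_sums.
Context {R : realType}.
Implicit Types (g V : R -> R) (y : nat -> R) (a b I : R) (n : nat).

Lemma stieltjes_sum_seq g V a b I : is_stieltjes_integral g V a b I ->
  forall e : R, 0 < e -> exists2 d : R, 0 < d & forall n y,
    y 0 = a -> y n = b -> (forall i, (i < n)%N -> y i < y i.+1 < y i + d) ->
    `|\sum_(0 <= i < n) g (y i) * (V (y i.+1) - V (y i)) - I| < e.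
Proof.
move=> gVI e e0; have [d d0 H] := gVI e e0; exists d => // n y y0 yn yd.
pose s := mkseq (fun i => y i.+1) n.
have ys i : (i <= n)%N -> nth b (a :: s) i = y i.
  by case: i => [//|i] ni /=; rewrite nth_mkseq.
have ss : size s = n by rewrite size_mkseq.
have -> : \sum_(0 <= i < n) g (y i) * (V (y i.+1) - V (y i)) =
    stieltjes_sum g V a b s y.
  rewrite /stieltjes_sum ss; apply: eq_big_nat => i /andP[_ ni].
  by rewrite (ys i (ltnW ni)) (ys i.+1 ni).
apply: H => [|i].
  split; last by rewrite (last_nth b) ss ys// yn.
  apply/(pathP b) => i; rewrite ss => ni.
  rewrite (ys i (ltnW ni)) (nth_mkseq _ _ ni).
  by have /andP[] := yd i ni.
rewrite ss => ni x; rewrite /x (ys i (ltnW ni)) (ys i.+1 ni).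
have /andP[h1 h2] := yd i ni; split; first by rewrite lexx ltW.
by rewrite ltrBlDl.
Qed.

Definition grid a b n (i : nat) : R := a + i%:R * ((b - a) / n%:R).

Lemma gridS a b n i : grid a b n i.+1 = grid a b n i + (b - a) / n%:R.
Proof. by rewrite /grid -natr1; ring. Qed.

Lemma grid0 a b n : grid a b n 0 = a.
Proof. by rewrite /grid mul0r addr0. Qed.

Lemma grid_last a b n : (0 < n)%N -> grid a b n n = b.
Proof.
move=> n0; have n1 : n%:R != 0 :> R by rewrite pnatr_eq0 -lt0n.
by rewrite /grid; field.
Qed.

Lemma grid_le a b n i k : a <= b -> (i <= k)%N -> grid a b n i <= grid a b n k.
Proof.
by move=> ab ik; rewrite lerD2l ler_wpM2r ?ler_nat// divr_ge0// subr_ge0.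
Qed.

Lemma grid_small a b (d : R) : 0 < d -> \forall n \near \oo, (b - a) / n%:R < d.
Proof.
move=> d0; near=> n.
have n0 : 0 < n%:R :> R by rewrite ltr0n; near: n; exact: nbhs_infty_gt.
rewrite ltr_pdivrMr// -ltr_pdivrMl// mulrC; near: n; exact: nbhs_infty_gtr.
Unshelve. all: by end_near. Qed.

(** The given integrals both start at [a]. Gluing a fine grid of [a, b] to one of [b, c] gives a
    division of [a, c]; its sum approximates J, its first part approximates I, and the difference is
    the sum over the grid of [b, c]. *)
Lemma stieltjes_tail_grid g V a b c I J : a < b -> b < c ->
  is_stieltjes_integral g V a b I -> is_stieltjes_integral g V a c J ->
  forall e : R, 0 < e -> \forall n \near \oo,
    `|\sum_(0 <= i < n)
        g (grid b c n i) * (V (grid b c n i.+1) - V (grid b c n i)) - (J - I)| < e.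
Proof.
move=> ab bc gI gJ e e0; have e2 : 0 < e / 2 by rewrite divr_gt0.
have [d1 d10 H1] := stieltjes_sum_seq _ _ _ _ _ gI _ e2.
have [d2 d20 H2] := stieltjes_sum_seq _ _ _ _ _ gJ _ e2.
near \oo => n1; near=> n.
have n10 : (0 < n1)%N by near: n1; exact: nbhs_infty_gt.
have n0 : (0 < n)%N by near: n; exact: nbhs_infty_gt.
have s1 : (b - a) / n1%:R < Num.min d1 d2.
  by near: n1; apply: grid_small; rewrite lt_min d10.
have s2 : (c - b) / n%:R < Num.min d1 d2.
  by near: n; apply: grid_small; rewrite lt_min d10.
have p1 : 0 < (b - a) / n1%:R by rewrite divr_gt0 ?ltr0n// subr_gt0.
have p2 : 0 < (c - b) / n%:R by rewrite divr_gt0 ?ltr0n// subr_gt0.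
move: s1 s2; rewrite !lt_min => /andP[s11 s12] /andP[s21 s22].
pose y i := if (i <= n1)%N then grid a b n1 i else grid b c n (i - n1).
have yl i : (i <= n1)%N -> y i = grid a b n1 i by rewrite /y => ->.
have yr i : y (n1 + i)%N = grid b c n i.
  case: i => [|i]; last by rewrite /y addnS ltnNge leq_addr/= subSn ?leq_addr// addKn.
  by rewrite addn0 yl// grid0 grid_last.
have := H1 n1 y; rewrite !yl// grid0 grid_last// => /(_ erefl erefl).
have := H2 (n1 + n)%N y; rewrite yl// yr grid0 grid_last// => /(_ erefl erefl).
move=> {}H2 {}H1.
have {H1} : `|\sum_(0 <= i < n1) g (y i) * (V (y i.+1) - V (y i)) - I| < e / 2.
  apply: H1 => i ni; rewrite !yl//; last exact: ltnW.
  by rewrite gridS ltrDl p1 ltrD2l.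
have {H2} : `|\sum_(0 <= i < n1 + n) g (y i) * (V (y i.+1) - V (y i)) - J| < e / 2.
  apply: H2 => i _; have [ni|ni] := ltnP i n1.
    by rewrite !yl ?(ltnW ni)// gridS ltrDl p1 ltrD2l.
  rewrite -(subnKC ni) -addnS !yr gridS ltrDl p2 ltrD2l.
  by [].
rewrite (big_cat_nat _ (leq_addr n n1))//=.
rewrite -{2}[n1]add0n big_addn addKn.
have -> : \sum_(0 <= i < n)
      g (y (i + n1)%N) * (V (y (i + n1).+1) - V (y (i + n1)%N)) =
    \sum_(0 <= i < n)
      g (grid b c n i) * (V (grid b c n i.+1) - V (grid b c n i)).
  by apply: eq_bigr => i _; rewrite -addSn !(addnC _ n1) !yr.
by rewrite !ltr_norml; lra.
Unshelve. all: by end_near. Qed.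

End stieltjes_sums.

(** * Riemann sums of a function of bounded variation against a primitive *)

Section riemann_sums.
Context {R : realType}.
Notation mu := (@lebesgue_measure R).
Implicit Types (h p P W : R -> R) (a b : R) (D : set R).

Lemma continuous_itv_bounded p a b : a <= b ->
  (forall t, a <= t <= b -> {for t, continuous p}) ->
  exists2 B : R, 0 <= B & forall t : R, a <= t <= b -> `|p t| <= B.
Proof.
move=> ab cp.
have [c _ pc] : exists2 c, c \in `[a, b] &
    forall t, t \in `[a, b] -> `|p t| <= `|p c|.
  apply: (EVT_max (f := fun t => `|p t|)) => //; apply: continuous_on_itv => t tab.
  by apply: continuous_comp; [exact: cp|exact: norm_continuous].
by exists `|p c| => // t tab; apply: pc; rewrite in_itv.
Qed.

Lemma integrableM_continuous D h p a b : measurable D -> D `<=` `[a, b] ->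
  mu.-integrable D (EFin \o h) ->
  (forall t, a <= t <= b -> {for t, continuous p}) ->
  mu.-integrable D (EFin \o (fun t => h t * p t)).
Proof.
move=> mD Dab ih cp.
have [ab|ba] := leP a b; last first.
  have -> : D = set0.
    by apply/seteqP; split=> // t /Dab; rewrite set_itv_ge// bnd_simp -ltNge.
  exact: integrable_set0.
suff : mu.-integrable D ((EFin \o h) \* (EFin \o p))%E by [].
apply: integrableMl => //.
- apply: (measurable_funS _ Dab); first exact: measurable_itv.
  by have /integrableP[/measurable_EFinP] := integrable_continuous _ _ _ cp.
- have [B B0 pB] := continuous_itv_bounded _ _ _ ab cp.
  exists B; split; first exact: num_real.
  move=> x Bx t /Dab; rewrite /= in_itv/= => /pB ptB.
  by rewrite (le_trans ptB)// ltW.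
Qed.

(** Freezing [h] at the left end makes the integral exact by the fundamental theorem; the error is
    the integral of (h - h a) p. *)
Lemma riemann_cell h p P (D B : R) a b : a <= b ->
  mu.-integrable `[a, b] (EFin \o h) ->
  (forall t, a <= t <= b -> `|h t - h a| <= D) ->
  (forall t, a <= t <= b -> {for t, continuous p}) ->
  (forall t, a <= t <= b -> `|p t| <= B) ->
  (forall t, a <= t <= b -> is_derive t 1 P (p t)) ->
  `|\int[mu]_(t in `[a, b]) (h t * p t) - h a * (P b - P a)| <= D * B * (b - a).
Proof.
move=> ab ih hD cp pB dP.
have mab : measurable (`[a, b]%classic : set R) by exact: measurable_itv.
have ic (c : R) : mu.-integrable `[a, b] (EFin \o cst c).
  by apply: integrable_continuous => t _; exact: cst_continuous.
have ip := integrable_continuous _ _ _ cp.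
have ihp : mu.-integrable `[a, b] (EFin \o (fun t => h t * p t)).
  exact: (integrableM_continuous _ _ _ a b).
have icp : mu.-integrable `[a, b] (EFin \o (fun t => h a * p t)).
  exact: (integrableM_continuous _ (cst (h a)) _ a b).
have ihcp : mu.-integrable `[a, b] (EFin \o (fun t => h t * p t - h a * p t)).
  suff : mu.-integrable `[a, b] ((EFin \o (fun t => h t * p t)%R) \-
    (EFin \o (fun t => h a * p t)%R))%E by [].
  exact: integrableB.
rewrite -(Rintegral_FTC2 P p)// -RintegralZl// -RintegralB//.
rewrite (le_trans (le_normr_Rintegral _ _))//.
have <- : \int[mu]_(t in `[a, b]) (cst (D * B) t) = D * B * (b - a).
  rewrite Rintegral_cst//; have := lebesgue_measure_itv `[a, b].
  rewrite /= lte_fin => ->.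
  move: ab; rewrite le_eqVlt => /predU1P[->|ab]; first by rewrite ltxx subrr.
  by rewrite ab.
apply: le_Rintegral => //; first exact: integrable_norm ihcp.
move=> t; rewrite /= in_itv/= => tab.
by rewrite -mulrBl normrM ler_pM// ?hD// pB.
Qed.

(** The increments of [W] dominate those of [h], so the errors of the cells telescope and their sum
    is O(1/n) even where [h] jumps. *)
Lemma riemann_grid h p P W (B : R) a b n : a <= b -> (0 < n)%N ->
  mu.-integrable `[a, b] (EFin \o h) ->
  (forall s t, a <= s -> s <= t -> t <= b -> `|h t - h s| <= W t - W s) ->
  (forall t, a <= t <= b -> {for t, continuous p}) ->
  (forall t, a <= t <= b -> `|p t| <= B) ->
  (forall t, a <= t <= b -> is_derive t 1 P (p t)) ->
  `|\int[mu]_(t in `[a, b]) (h t * p t) -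
    \sum_(0 <= i < n) h (grid a b n i) * (P (grid a b n i.+1) - P (grid a b n i))|
  <= (W b - W a) * B * ((b - a) / n%:R).
Proof.
move=> ab n0 ih hW cp pB dP.
pose x := grid a b n.
have xa i : a <= x i by rewrite -(grid0 a b n) grid_le.
have xb i : (i <= n)%N -> x i <= b.
  by move=> ni; rewrite -[leRHS](grid_last a b n)// grid_le.
have xS i : x i <= x i.+1 by exact: grid_le.
have ihp : mu.-integrable `[a, b] (EFin \o (fun t => h t * p t)).
  by apply: (integrableM_continuous _ _ _ a b) => //; exact: measurable_itv.
suff main k : (k <= n)%N -> `|\int[mu]_(t in `[a, x k]) (h t * p t) -
    \sum_(0 <= i < k) h (x i) * (P (x i.+1) - P (x i))|
    <= (W (x k) - W a) * B * ((b - a) / n%:R).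
  have xn : x n = b by exact: grid_last.
  by have := main n (leqnn n); rewrite xn.
elim: k => [_|k IH kn].
  rewrite /x grid0 big_geq// subr0 set_itv1 Rintegral_set1 normr0.
  by rewrite subrr !mul0r.
have sub c d : a <= c -> d <= b -> mu.-integrable `[c, d] (EFin \o h).
  move=> ac db; apply: integrableS ih => //.
  by apply: subset_itvScc; rewrite bnd_simp.
have cell := riemann_cell h p P (W (x k.+1) - W (x k)) B (x k) (x k.+1) (xS k).
have inab t : x k <= t <= x k.+1 -> a <= t <= b.
  by case/andP=> kt tk; rewrite (le_trans (xa k))//= (le_trans tk)// xb.
have {cell} : `|\int[mu]_(t in `[x k, x k.+1]) (h t * p t) -
    h (x k) * (P (x k.+1) - P (x k))| <=
    (W (x k.+1) - W (x k)) * B * ((b - a) / n%:R).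
  rewrite [X in _ <= _ * X](_ : _ = x k.+1 - x k); last by rewrite /x gridS; ring.
  apply: cell.
  - by apply: sub; [exact: xa|exact: xb].
  - move=> t /andP[kt tk]; apply: (le_trans (hW _ _ (xa k) kt _)).
      by rewrite (le_trans tk)// xb.
    rewrite lerD2r -subr_ge0; apply: le_trans (hW _ _ _ tk (xb _ kn)) => //.
    by rewrite (le_trans _ kt).
  - by move=> t /inab; exact: cp.
  - by move=> t /inab; exact: pB.
  - by move=> t /inab; exact: dP.
have itf k' : (k' <= n)%N ->
    mu.-integrable `[a, x k'] (EFin \o (fun t => h t * p t)).
  by move=> k'n; apply: integrableS ihp => //; apply: subset_itvScc; rewrite ?bnd_simp ?xb.
have {IH} := IH (ltnW kn).
have -> : \int[mu]_(t in `[a, x k.+1]) (h t * p t) =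
    \int[mu]_(t in `[a, x k]) (h t * p t) +
    \int[mu]_(t in `[x k, x k.+1]) (h t * p t).
  rewrite -[X in _ = _ + X]Rintegral_itv_obnd_cbnd; last first.
    by apply: integrableS (itf k.+1 kn) => //; apply: subset_itvScc; rewrite ?bnd_simp.
  by rewrite -(Rintegral_itvB (x := x k) (itf k.+1 kn)) ?bnd_simp// addrC subrK.
rewrite big_nat_recr//=.
set u1 := \int[_]_(_ in _) _; set u2 := \int[_]_(_ in _) _ => I1 I2.
have -> : forall A B' : R, u1 + u2 - (A + B') = (u1 - A) + (u2 - B').
  by move=> A B'; ring.
rewrite (le_trans (ler_normD _ _))// (le_trans (lerD I1 I2))//.
by rewrite le_eqVlt; apply/orP; left; apply/eqP; ring.
Qed.

End riemann_sums.

(** * Integrals of a weighted function of bounded variation *)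

Section weighted_bounded_variation.
Context {R : realType}.
Notation mu := (@lebesgue_measure R).
Implicit Types (f V p P : R -> R) (a b M N : R).

Lemma powR_sign_variation b : exists2 sg : R, sg = 1 \/ sg = - 1 &
  forall s t : R, 0 < s -> s <= t -> `|t `^ b - s `^ b| = sg * (t `^ b - s `^ b).
Proof.
have le_pow (q s t : R) : 0 <= q -> 0 < s -> s <= t -> s `^ q <= t `^ q.
  move=> q0 s0 st; apply: ge0_ler_powR => //; rewrite nnegrE ltW//.
  exact: lt_le_trans s0 st.
have [b0|b0] := leP 0 b.
  exists 1 => [|s t s0 st]; first by left.
  by rewrite mul1r ger0_norm// subr_ge0 le_pow.
exists (- 1) => [|s t s0 st]; first by right.
have t0 : 0 < t by exact: lt_le_trans s0 st.
rewrite mulN1r ler0_norm// subr_le0.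
rewrite -[b]opprK !(powRN _ (- b)) lef_pV2 ?posrE ?powR_gt0//.
by apply: le_pow; rewrite // oppr_ge0 ltW.
Qed.

(** The integral is approximated by the sum of h = t^b f against the increments of P, Abel summation
    bounds this by the variation of h, and the latter by a Stieltjes sum tending to J - I. The term
    at N counts twice: once as the boundary term of Abel summation, once in the variation. *)
Lemma weighted_integral_bound f V p P (b C I J : R) a M N :
  0 < a -> a < M -> M < N ->
  mu.-integrable `[M, N] (EFin \o f) ->
  (forall s t, M <= s -> s <= t -> t <= N -> `|f t - f s| <= V t - V s) ->
  is_stieltjes_integral (fun t => t `^ b) V a M I ->
  is_stieltjes_integral (fun t => t `^ b) V a N J ->
  (forall t, M <= t <= N -> {for t, continuous p}) ->
  (forall t, M <= t <= N -> is_derive t 1 P (p t)) ->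
  (forall t : R, 0 < t -> `|P t| <= C) ->
  `|\int[mu]_(t in `[M, N]) (t `^ b * f t * p t)| <=
  2 * C * (2 * (J - I) + M `^ b * `|f M| + 2 * (N `^ b * `|f N|)).
Proof.
move=> a0 aM MN intf fV stI stJ cp dP PC.
have M0 : 0 < M by exact: lt_trans a0 aM.
have C0 : 0 <= C by rewrite (le_trans _ (PC M M0)).
have MN' := ltW MN.
have gcont t : M <= t <= N -> {for t, continuous (fun t : R => t `^ b)}.
  case/andP=> Mt _; apply: is_derive_continuous.
  by apply: is_derive1_powR; rewrite (lt_le_trans M0).
have [B2 B20 gB] := continuous_itv_bounded _ _ _ MN' gcont.
have [B B0 pB] := continuous_itv_bounded _ _ _ MN' cp.
have [sg sg1 dg] := powR_sign_variation b.
pose B1 := `|f M| + (V N - V M).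
have VN s t : M <= s -> s <= t -> t <= N -> 0 <= V t - V s.
  by move=> Ms st tN; rewrite (le_trans _ (fV _ _ Ms st tN)).
have fB1 t : M <= t <= N -> `|f t| <= B1.
  case/andP=> Mt tN; have := fV M t (lexx _) Mt tN; have := VN t N Mt tN (lexx _).
  by have := ler_distD (f M) (f t) 0; rewrite !subr0 /B1; lra.
pose h t := t `^ b * f t.
(* A function whose increments dominate those of h, by the product rule: [B1] bounds |f| and [B2]
   bounds t^b on [M, N]. *)
pose W t := B1 * (sg * t `^ b) + B2 * V t.
have hW s t : M <= s -> s <= t -> t <= N -> `|h t - h s| <= W t - W s.
  move=> Ms st tN; have s0 : 0 < s by exact: lt_le_trans M0 Ms.
  have -> : h t - h s = (t `^ b - s `^ b) * f t + s `^ b * (f t - f s).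
    by rewrite /h; ring.
  rewrite (le_trans (ler_normD _ _))// !normrM dg//.
  have -> : W t - W s = sg * (t `^ b - s `^ b) * B1 + B2 * (V t - V s).
    by rewrite /W; ring.
  apply: lerD.
    by rewrite ler_wpM2l -?dg// fB1// tN (le_trans Ms).
  by rewrite ler_pM// ?fV// gB// Ms (le_trans st).
have inth : mu.-integrable `[M, N] (EFin \o h).
  have -> : h = (fun t => f t * t `^ b) by apply/funext => t; rewrite /h mulrC.
  by apply: (integrableM_continuous _ _ _ M N) => //; exact: measurable_itv.
apply/ler_addgt0Pr => e e0.
(* The Stieltjes error will enter with the factor 4 C and must cost at most e / 2; [C + 1] keeps the
   divisor positive. *)
have e1 : 0 < e / (8 * (C + 1)) by rewrite divr_gt0//; lra.
near \oo => n.
have n0 : (0 < n)%N by near: n; exact: nbhs_infty_gt.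
have st : `|\sum_(0 <= i < n) grid M N n i `^ b *
    (V (grid M N n i.+1) - V (grid M N n i)) - (J - I)| < e / (8 * (C + 1)).
  by near: n; apply: stieltjes_tail_grid stI stJ _ e1.
(* Subtracting 0 gives the error bound of [riemann_grid] the shape of [grid_small]. *)
have small : ((W N - W M) * B * (N - M) - 0) / n%:R < e / 2.
  by near: n; apply: grid_small; rewrite divr_gt0.
have riem := riemann_grid h p P W B M N n MN' n0 inth hW cp pB dP.
have x0 i : 0 < grid M N n i.
  by rewrite (lt_le_trans M0)// -[leLHS](grid0 M N n) grid_le.
have Pbound i : `|P (grid M N n i) - P (grid M N n 0)| <= 2 * C.
  by rewrite (le_trans (ler_normB _ _))// mulr_natl mulr2n lerD// PC.
have abel := sum_abel (fun i => h (grid M N n i)) (fun i => P (grid M N n i)) n _ Pbound.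
have var := sum_variation_mul (fun i => grid M N n i `^ b) (fun i => f (grid M N n i))
  (fun i => V (grid M N n i)) n sg.
have {}var := var (fun i => powR_ge0 _ _).
have {}var := var (fun i => dg _ _ (x0 i) (grid_le _ _ n _ _ MN' (leqnSn i))) sg1.
have {}var : \sum_(0 <= i < n) `|h (grid M N n i.+1) - h (grid M N n i)| <=
    2 * \sum_(0 <= i < n) grid M N n i `^ b *
      (V (grid M N n i.+1) - V (grid M N n i)) +
    M `^ b * `|f M| + N `^ b * `|f N|.
  have := var; rewrite grid0 grid_last//; apply => i ni; apply: fV.
  - by rewrite -[leLHS](grid0 M N n) grid_le.
  - by rewrite grid_le.
  - by rewrite -[leRHS](grid_last M N n n0) grid_le.
rewrite grid_last// {2}/h normrM (ger0_norm (powR_ge0 _ _)) in abel.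
set A := \sum_(0 <= i < n) _ in abel riem; set S := \sum_(0 <= i < n) _ in st var.
set X := \int[_]_(_ in _) _ in riem *.
have {}riem : `|X - A| <= e / 2.
  by rewrite (le_trans riem)// ltW// mulrA; move: small; rewrite subr0.
have {}abel : `|A| <= 2 * C *
    (N `^ b * `|f N| + (2 * S + M `^ b * `|f M| + N `^ b * `|f N|)).
  by rewrite (le_trans abel)// ler_wpM2l ?mulr_ge0// lerD2l.
have Ce : 4 * C * (e / (8 * (C + 1))) <= e / 2.
  rewrite mulrA ler_pdivrMr; last by lra.
  by nra.
have CS : C * S <= C * (J - I + e / (8 * (C + 1))).
  by rewrite ler_wpM2l//; move: st; rewrite ltr_norml; lra.
have XA : `|X| <= `|A| + `|X - A|.
  by have := ler_distD A X 0; rewrite !subr0 addrC.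
rewrite (le_trans XA)// (le_trans (lerD abel riem))//.
move: (M `^ b * _) (N `^ b * _) (e / (8 * _)) CS Ce; clear=> m k e' CS Ce.
lra.
Unshelve. all: by end_near. Qed.

End weighted_bounded_variation.

(** * Uniform convergence *)

Section complex_uniform_convergence.
Context {R : realType}.
Local Notation Re := complex.Re.
Local Notation Im := complex.Im.
Implicit Types (F : R -> R -> R[i]^o) (E : set R) (z : R[i]).

Lemma ler_Re_normc z : `|Re z| <= normc z.
Proof.
by case: z => a b /=; rewrite -sqrtr_sqr ler_wsqrtr// lerDl sqr_ge0.
Qed.

Lemma ler_Im_normc z : `|Im z| <= normc z.
Proof.
by case: z => a b /=; rewrite -sqrtr_sqr ler_wsqrtr// lerDr sqr_ge0.
Qed.

Lemma ler_normc_ReIm z : normc z <= `|Re z| + `|Im z|.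
Proof.
case: z => a b /=; rewrite -[leRHS]ger0_norm ?addr_ge0// -sqrtr_sqr ler_wsqrtr//.
rewrite sqrrD !real_normK ?num_real// lerD2r lerDl.
by rewrite mulrn_wge0// mulr_ge0.
Qed.

(** Non-strict bounds pass to the limit, so any bound on the tail beyond [M] also bounds the
    distance of the limit from u M. This quantitative form is what gives uniformity later. *)
Lemma real_cauchy_cvgy (u : R -> R) :
  (forall e : R, 0 < e -> exists M0, forall M N, M0 <= M -> M <= N ->
    `|u N - u M| <= e) ->
  exists l, forall e M, 0 < e ->
    (forall N, M <= N -> `|u N - u M| <= e) -> `|l - u M| <= e.
Proof.
move=> cu; have cv : cvg (u N @[N --> +oo]).
  apply: cauchy_cvg; apply: cauchy_exP => e e0.
  have e2 : 0 < e / 2 by rewrite divr_gt0.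
  have [M0 H] := cu (e / 2) e2.
  exists (u M0); exists M0; split; first exact: num_real.
  move=> N M0N; rewrite /ball/= distrC.
  by rewrite (le_lt_trans (H M0 N (lexx _) (ltW M0N)))//; lra.
exists (lim (u N @[N --> +oo])) => e M e0 H.
apply/ler_addgt0Pr => d d0.
have /cvgrPdist_lt/(_ d d0) near_l := cv.
near +oo_R => N.
have h1 : `|lim (u N @[N --> +oo]) - u N| < d by near: N.
have MN : M <= N by near: N; apply: nbhs_pinfty_ge; rewrite num_real.
have := H N MN; have := ler_distD (u N) (lim (u N @[N --> +oo])) (u M).
by move: h1; lra.
Unshelve. all: by end_near. Qed.

Lemma complex_uniform_cauchy F E :
  (forall e : R, 0 < e -> exists M0, forall M N r, M0 <= M -> M <= N -> E r ->
    `|Re (F N r) - Re (F M r)| <= e /\ `|Im (F N r) - Im (F M r)| <= e) ->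
  (forall r, E r -> cvg (F N r @[N --> +oo])) /\
  {uniform E, F N @[N --> +oo] --> (fun r => lim (F N r @[N --> +oo]))}.
Proof.
move=> cF.
(* The condition [E r] stands inside the existential so that choice yields a limit function defined
   everywhere. *)
have ex_lim r : exists l : R[i]^o, E r -> forall e M, 0 < e ->
    (forall N, M <= N ->
      `|Re (F N r) - Re (F M r)| <= e /\ `|Im (F N r) - Im (F M r)| <= e) ->
    normc (l - F M r) <= 2 * e.
  have [Er|nEr] := pselect (E r); last by exists 0.
  have [|a ha] := real_cauchy_cvgy (fun N => Re (F N r)).
    by move=> e /cF[M0 H]; exists M0 => M N M0M MN; have [] := H M N r M0M MN Er.
  have [|b hb] := real_cauchy_cvgy (fun N => Im (F N r)).
    by move=> e /cF[M0 H]; exists M0 => M N M0M MN; have [] := H M N r M0M MN Er.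
  exists (a +i* b) => _ e M e0 H.
  have {}ha := ha e M e0 (fun N MN => proj1 (H N MN)).
  have {}hb := hb e M e0 (fun N MN => proj2 (H N MN)).
  rewrite (le_trans (ler_normc_ReIm _))//.
  by move: ha hb; case: (F M r) => x y /=; lra.
pose L r := projT1 (cid (ex_lim r)).
have LP r : E r -> forall e M, 0 < e ->
    (forall N, M <= N ->
      `|Re (F N r) - Re (F M r)| <= e /\ `|Im (F N r) - Im (F M r)| <= e) ->
    normc (L r - F M r) <= 2 * e.
  by rewrite /L; case: cid.
have unif (e : R) : 0 < e -> \forall N \near +oo, forall r, E r ->
    normc (L r - F N r) < e.
  move=> e0; have [|M0 H] := cF (e / 4); first by rewrite divr_gt0.
  near=> M => r Er; rewrite (@le_lt_trans _ _ (2 * (e / 4)))//; last by lra.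
  apply: LP => //; first by rewrite divr_gt0.
  by move=> N MN; apply: H => //; near: M; apply: nbhs_pinfty_ge; rewrite num_real.
(* A positive element of [R[i]] has zero imaginary part, so the radii of the complex topology reduce
   to real ones. *)
have posC (e : R[i]) : 0 < e -> exists2 d : R, 0 < d & e = d%:C.
  by case: e => x y; rewrite ltcE/= => /andP[/eqP -> x0]; exists x.
have normE (z : R[i]^o) : `|z| = (normc z)%:C by case: z => x y; rewrite normc_def.
have cvgL r : E r -> F N r @[N --> +oo] --> L r.
  move=> Er; apply/cvgrPdist_lt => e /posC[d d0 ->].
  near=> N; rewrite normE ltcR.
  by near: N; move: (unif d d0); apply: filterS => N; exact.
split; first by move=> r Er; apply/cvg_ex; exists (L r); exact: cvgL.
move=> P /uniform_nbhs [A [entA AP]].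
move: entA; rewrite -entourage_ballE => -[/= e e0 eA].
have [d d0 ed] := posC _ e0.
near=> N; apply: AP => r Er; apply: eA => /=.
have -> : lim (F N r @[N --> +oo]) = L r by apply: cvg_lim => //; exact: cvgL.
rewrite /ball/= ed normE ltcR.
by move: r Er; near: N; exact: unif.
Unshelve. all: by end_near. Qed.

End complex_uniform_convergence.

(** * Tails of the Hankel transform *)

Section complex_variation.
Context {R : realType}.
Implicit Types (f : R -> R[i]) (a b s t : R) (x : seq R).

Lemma cvariation_rcons a b t f x : itv_partition a b x ->
  cvariation a t f (rcons x t) = cvariation a b f x + normc (f t - f b).
Proof.
move=> [_ /eqP xb]; rewrite /cvariation size_rcons big_nat_recr//=; congr (_ + _).
  apply: eq_big_nat => i /andP[_ ix].
  (* The default value of [nth] is the right end, which changes from [b] to [t]; the indices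
     concerned are in range. *)
  have nthE k : (k <= size x)%N -> nth t (a :: rcons x t) k = nth b (a :: x) k.
    move=> kx; rewrite -rcons_cons nth_rcons /= ltnS kx.
    by apply: set_nth_default; rewrite /= ltnS.
  by have := nthE i.+1 ix; have := nthE i (ltnW ix); rewrite /= => -> ->.
rewrite -rcons_cons !nth_rcons/= ltnn eqxx ltnS leqnn.
congr (normc (f t - f _)); rewrite -xb (last_nth t).
by [].
Qed.

(** Appending [t] to a division of [a, s] adds |f t - f s| to its variation and gives a division of
    [a, t]; then the supremum is taken. *)
Lemma ctotal_variation_increment a s t f : a <= s -> s <= t ->
  cbounded_variation a t f ->
  normc (f t - f s) <= ctotal_variation a t f - ctotal_variation a s f.
Proof.
rewrite [s <= t]le_eqVlt => sa /predU1P[->|st] bvt.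
  by rewrite !subrr normc0.
rewrite lerBrDr addrC -lerBrDr; apply: sup_le_ub.
  move: sa; rewrite le_eqVlt => /predU1P[->|sa].
    by exists (cvariation s s f [::]); exists [::] => //; split => //=.
  by exists (cvariation a s f [:: s]); exists [:: s] => //; exact: itv_partition1.
move=> _ [x xp <-]; rewrite lerBrDr -(cvariation_rcons _ _ t)//.
apply: ub_le_sup => //; exists (rcons x t) => //.
have [px /eqP lx] := xp.
by split; [rewrite rcons_path px lx|rewrite last_rcons].
Qed.

End complex_variation.

Section hankel_tails.
Context {R : realType} {alpha nu : R}.
Notation mu := (@lebesgue_measure R).
Hypothesis halpha : - (1 / 2) <= alpha.
Let b := nu - alpha - 1 / 2.

(** The bracket of [weighted_integral_bound] with |f| replaced by a majorant [F], so that real and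
    imaginary parts share one weight. *)
Definition tail_weight (F I : R -> R) (M N : R) : R :=
  2 * (I N - I M) + M `^ b * F M + 2 * (N `^ b * F N).

Lemma integrable_powR_cut (g : R -> R) (N : R) :
  mu.-integrable `]0, 1[ (EFin \o (fun t => t `^ nu * g t)) ->
  locally_integrable `]0, +oo[ g ->
  mu.-integrable `]0, N] (EFin \o (fun t => t `^ nu * g t)).
Proof.
move=> g01 [mg _ gloc].
(* Beyond 1 the power t^nu is continuous and local integrability suffices; the maximum covers the
   case [N < 1]. *)
have gN : mu.-integrable `[1, Num.max 1 N] (EFin \o (fun t => t `^ nu * g t)).
  have -> : (fun t => t `^ nu * g t) = (fun t => g t * t `^ nu).
    by apply/funext => t; rewrite mulrC.
  have sub : `[1, Num.max 1 N] `<=` (`]0, +oo[%classic : set R).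
    by move=> t; rewrite /= !in_itv/= andbT => /andP[t1 _]; exact: lt_le_trans t1.
  apply: (integrableM_continuous _ _ _ 1 (Num.max 1 N)) => //.
    apply/integrableP; split.
      by apply/measurable_EFinP; apply: measurable_funS mg.
    by apply: gloc => //; exact: segment_compact.
  move=> t /andP[t1 _]; have t0 : 0 < t by exact: lt_le_trans t1.
  exact: is_derive_continuous (is_derive1_powR nu t0).
have : mu.-integrable (`]0, 1[ `|` `[1, Num.max 1 N])
    (EFin \o (fun t => t `^ nu * g t)).
  have /integrableP[m1 i1] := g01; have /integrableP[m2 i2] := gN.
  have mU : measurable_fun (`]0, 1[ `|` `[1, Num.max 1 N])
      (EFin \o (fun t => t `^ nu * g t)).
    by apply/measurable_funU => //; exact: measurable_itv.
  apply/integrableP; split => //.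
  rewrite ge0_integral_setU//=; [exact: lte_add_pinfty| | ].
    apply/measurable_EFinP; apply: measurableT_comp => //.
    exact/measurable_EFinP.
  apply/disj_setPS => t [/=]; rewrite !in_itv/= => /andP[_ t1] /andP[t1' _].
  by move: t1; rewrite ltNge t1'.
apply: integrableS => //; first exact: measurableU.
move=> t; rewrite /= !in_itv/= => /andP[t0 tN].
have [t1|t1] := ltP t 1; [left|right] => //.
  by rewrite t0.
by rewrite le_max tN orbT.
Qed.

(** The constant is chosen before [g] and [r], so the dependence on [r] is entirely in the power of
    [r], which comes from scaling the bounded primitive. *)
Lemma hankel_tail_bound : exists2 C : R, 0 <= C &
  forall (F I V g : R -> R),
  (forall s t, 1 <= s -> s <= t -> `|g t - g s| <= V t - V s) ->
  (forall t, `|g t| <= F t) ->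
  (forall N, 1 <= N -> is_stieltjes_integral (fun t => t `^ b) V 1 N (I N)) ->
  mu.-integrable `]0, 1[ (EFin \o (fun t => t `^ nu * g t)) ->
  locally_integrable `]0, +oo[ g ->
  forall r M N, 0 < r -> 1 < M -> M < N ->
  `|\int[mu]_(t in `]0, N]) (t `^ nu * g t * normalized_bessel alpha (r * t)) -
    \int[mu]_(t in `]0, M]) (t `^ nu * g t * normalized_bessel alpha (r * t))|
  <= C * r `^ (- (alpha + 3 / 2)) * tail_weight F I M N.
Proof.
have [j [Om [C [cj jE dOm OmC]]]] := normalized_bessel_primitive halpha.
exists (2 * C) => [|F I V g gV gF stI g01 gloc r M N r0 M1 MN].
  by rewrite mulr_ge0// (le_trans _ (OmC 1 ltr01)).
have M0 : 0 < M by exact: lt_trans M1.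
have jrE t : 0 < t -> normalized_bessel alpha (r * t) = j (r * t).
  by move=> t0; rewrite jE// mulr_gt0.
have cjr t : {for t, continuous (fun t => j (r * t))}.
  apply: continuous_comp; last exact: cj.
  exact: mulrl_continuous.
have intN K : mu.-integrable `]0, K]
    (EFin \o (fun t => t `^ nu * g t * j (r * t))).
  apply: (integrableM_continuous _ _ _ 0 K).
  - exact: measurable_itv.
  - by apply: subset_itvr; rewrite bnd_simp.
  - exact: integrable_powR_cut.
  - by move=> t _; exact: cjr.
have cut K : \int[mu]_(t in `]0, K])
      (t `^ nu * g t * normalized_bessel alpha (r * t)) =
    \int[mu]_(t in `]0, K]) (t `^ nu * g t * j (r * t)).
  apply: eq_Rintegral => t; rewrite inE/= in_itv/= => /andP[t0 _].
  by rewrite jrE.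
rewrite !cut (Rintegral_itvB (intN N)) ?bnd_simp ?(ltW M0) ?(ltW MN)//.
rewrite Rintegral_itv_obnd_cbnd; last first.
  by apply: integrableS (intN N) => //; apply: subset_itvr; rewrite bnd_simp ltW.
pose p t := t `^ (alpha + 1 / 2) * j (r * t).
(* Differentiating Om(r t) produces r (r t)^(alpha + 1/2) j(r t), whose power of r is cancelled by
   the prefactor; what is left is [p]. *)
pose P t := r `^ (- (alpha + 3 / 2)) * Om (r * t).
have -> : \int[mu]_(t in `[M, N]) (t `^ nu * g t * j (r * t)) =
    \int[mu]_(t in `[M, N]) (t `^ b * g t * p t).
  apply: eq_Rintegral => t; rewrite inE/= in_itv/= => /andP[Mt _].
  have t0 : 0 < t by exact: lt_le_trans Mt.
  have -> : nu = b + (alpha + 1 / 2) by rewrite /b; ring.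
  rewrite powRD ?(gt_eqF t0) ?implybT// /p.
  by ring.
have Mpos t : M <= t <= N -> 0 < t by case/andP => + _; exact: lt_le_trans.
have [N1 MN1] : 1 <= N /\ 1 <= M by split; apply: ltW => //; exact: lt_trans MN.
have := @weighted_integral_bound R g V p P b
  (r `^ (- (alpha + 3 / 2)) * C) (I M) (I N) 1 M N ltr01 M1 MN.
move=> /(_ _ _ _ _ _ _ _)/le_trans; apply.
- have [mg _ gl] := gloc.
  have sub : `[M, N] `<=` (`]0, +oo[%classic : set R).
    by move=> t; rewrite /= !in_itv/= andbT => /Mpos.
  apply/integrableP; split.
    by apply/measurable_EFinP; apply: measurable_funS mg.
  by apply: gl => //; exact: segment_compact.
- by move=> s t Ms st tN; apply: gV => //; exact: le_trans Ms.
- exact: stI.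
- exact: stI.
- move=> t /Mpos t0; apply: cvgM; last exact: cjr.
  exact: is_derive_continuous (is_derive1_powR _ t0).
- move=> t /Mpos t0; have dO := dOm (r * t) (mulr_gt0 r0 t0).
  have dr : is_derive t 1 (fun t : R => r * t) r.
    by apply: is_derive_eq; rewrite /GRing.scale/=; ring.
  have dc : is_derive t 1 (fun t => Om (r * t))
      ((r * t) `^ (alpha + 1 / 2) * j (r * t) * r).
    exact: (@is_derive1_comp _ Om (fun t => r * t)).
  rewrite /P; apply: is_derive_eq; rewrite /GRing.scale/= /p.
  have -> : r `^ (- (alpha + 3 / 2)) = (r `^ (alpha + 1 / 2) * r)^-1.
    have -> : alpha + 3 / 2 = (alpha + 1 / 2) + 1 by field.
    by rewrite powRN powRD ?(gt_eqF r0) ?implybT// powRr1 ?ltW.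
  rewrite powRM ?ltW//.
  by field; rewrite (gt_eqF r0) gt_eqF ?powR_gt0.
- move=> t t0; rewrite /P normrM ger0_norm ?powR_ge0//.
  by rewrite ler_wpM2l ?powR_ge0// OmC// mulr_gt0.
move: (r `^ _) (powR_ge0 r (- (alpha + 3 / 2))) => q q0.
have -> : 2 * (q * C) = 2 * C * q by ring.
rewrite ler_wpM2l ?mulr_ge0 ?powR_ge0 ?(le_trans _ (OmC 1 ltr01))// /tail_weight.
have := gF M; have := gF N; have := powR_ge0 M b; have := powR_ge0 N b.
by nra.
Qed.

End hankel_tails.

(** * Uniform convergence of the Hankel transform *)

Section hankel_uniform.
Context {R : realType}.
Local Notation Re := complex.Re.
Local Notation Im := complex.Im.
Implicit Types (f : R -> R[i]) (alpha nu mu r M N : R) (E : set R).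

Lemma Re_hankel_partial alpha nu mu f N r :
  Re (hankel_partial alpha nu mu f N r) = r `^ (mu + nu) *
  \int[lebesgue_measure]_(t in `]0, N])
    (t `^ nu * Re (f t) * normalized_bessel alpha (r * t)).
Proof.
rewrite /hankel_partial /cintegral /= mul0r subr0; congr (_ * _).
apply: eq_Rintegral => t _.
by case: (f t) => x y /=; ring.
Qed.

Lemma Im_hankel_partial alpha nu mu f N r :
  Im (hankel_partial alpha nu mu f N r) = r `^ (mu + nu) *
  \int[lebesgue_measure]_(t in `]0, N])
    (t `^ nu * Im (f t) * normalized_bessel alpha (r * t)).
Proof.
rewrite /hankel_partial /cintegral /= mul0r addr0; congr (_ * _).
apply: eq_Rintegral => t _.
by case: (f t) => x y /=; ring.
Qed.

Lemma tail_weight_small nu alpha (F I : R -> R) :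
  cvg (I N @[N --> +oo]) ->
  M `^ (nu - alpha - 1 / 2) * F M @[M --> +oo] --> (0 : R) ->
  forall e : R, 0 < e -> exists2 M0 : R, 1 < M0 &
    forall M N, M0 <= M -> M0 <= N -> tail_weight (alpha := alpha) (nu := nu) F I M N <= e.
Proof.
move=> /cvgrPdist_lt cI /cvgrPdist_lt cF e e0.
(* The three terms of the weight contribute at most 4, 1 and 2 eighths of [e]. *)
have e8 : 0 < e / 8 by rewrite divr_gt0.
have [A [_ HA]] := cI _ e8; have [B [_ HB]] := cF _ e8.
exists (Num.max 1 (Num.max A B) + 1) => [|M N].
  by rewrite (@le_lt_trans _ _ (Num.max 1 (Num.max A B)))// ?ltrDl// le_max lexx.
have gtAB K : Num.max 1 (Num.max A B) + 1 <= K -> A < K /\ B < K.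
  move=> AB; have : Num.max 1 (Num.max A B) < K by apply: lt_le_trans AB; rewrite ltrDl.
  by rewrite !gt_max => /and3P[].
move=> /gtAB[AM BM] /gtAB[AN BN].
have := HA M AM; have := HA N AN; have := HB M BM; have := HB N BN.
rewrite /= /tail_weight !sub0r !normrN !ltr_norml; lra.
Qed.

(** Common source of all the cases: the tail is at most r^(mu + nu - alpha - 3/2) times a small
    quantity free of r, so bounding this power on [E] is enough. The point 0 is treated apart,
    through the vanishing of 0^(mu + nu). *)
Lemma hankel_uniform_on alpha nu mu f E (K : R) :
  - (1 / 2) <= alpha ->
  locally_bounded_variation_pos f ->
  clocally_integrable `]0, +oo[ f ->
  cintegrable `]0, 1[ (fun t => (t `^ nu)%:C * f t) ->
  finite_variation_integral (fun t => t `^ (nu - alpha - 1 / 2)) f 1 ->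
  M `^ (nu - alpha - 1 / 2) * normc (f M) @[M --> +oo] --> (0 : R) ->
  (forall r, E r -> 0 <= r) ->
  (E 0 -> mu + nu != 0) ->
  (forall r, E r -> r `^ (mu + nu - alpha - 3 / 2) <= K) ->
  (forall r, E r -> hankel_converges alpha nu mu f r) /\
  hankel_converges_uniformly alpha nu mu f E.
Proof.
move=> halpha fBV [fliR fliI] [fR fI] [I [stI cI]] f0 E0 E0nu EK.
apply: complex_uniform_cauchy => e e0.
have [C C0 tail] := hankel_tail_bound (nu := nu) halpha.
pose V t := ctotal_variation 1 t f.
have fV s t : 1 <= s -> s <= t -> normc (f t - f s) <= V t - V s.
  move=> s1 st; apply: ctotal_variation_increment => //.
  by apply: fBV; rewrite // (le_trans s1).
(* The absolute value and the added 1 make the divisor positive whatever the sign of [K]. *)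
have CK0 : 0 < C * `|K| + 1 by rewrite ltr_wpDl// mulr_ge0.
have [M0 M01 small] := tail_weight_small _ _ _ _ cI f0 (e / (C * `|K| + 1)) (divr_gt0 e0 CK0).
exists M0 => M N r M0M; rewrite le_eqVlt => /predU1P[-> _|MN Er].
  by rewrite !subrr normr0 ltW.
have [r0|r0] := eqVneq r 0.
  have z : r `^ (mu + nu) = 0 by rewrite r0 powR0// E0nu// -r0.
  by rewrite !Re_hankel_partial !Im_hankel_partial z !mul0r subrr normr0 ltW.
have {}r0 : 0 < r by rewrite lt_neqAle eq_sym r0 E0.
have M1 : 1 < M by exact: lt_le_trans M0M.
have est x : `|x| <= C * r `^ (- (alpha + 3 / 2)) *
      tail_weight (alpha := alpha) (nu := nu) (fun t => normc (f t)) I M N ->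
    `|r `^ (mu + nu) * x| <= e.
  move=> xle; rewrite normrM ger0_norm ?powR_ge0//.
  rewrite (le_trans (ler_wpM2l (powR_ge0 _ _) xle))//.
  have tw := small M N M0M (le_trans M0M (ltW MN)).
  have rE : r `^ (mu + nu) * r `^ (- (alpha + 3 / 2)) = r `^ (mu + nu - alpha - 3 / 2).
    by rewrite -powRD ?(gt_eqF r0) ?implybT//; congr powR; ring.
  rewrite mulrA mulrCA rE.
  have qK : r `^ (mu + nu - alpha - 3 / 2) <= `|K|.
    by rewrite (le_trans (EK r Er))// ler_norm.
  rewrite (le_trans (ler_wpM2l _ tw)) ?mulr_ge0 ?powR_ge0//.
  rewrite mulrCA ler_piMr ?(ltW e0)// ler_pdivrMr// mul1r ler_wpDr//.
  by rewrite ler_wpM2l.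
rewrite !Re_hankel_partial !Im_hankel_partial -!mulrBr; split; apply: est.
- apply: (tail (fun t => normc (f t)) I V (fun t => Re (f t))) => //.
  + move=> s t s1 st; rewrite (le_trans _ (fV s t s1 st))// -raddfB.
    exact: ler_Re_normc.
  + by move=> t; exact: ler_Re_normc.
  + suff -> : (fun t => t `^ nu * Re (f t)) = (fun t => Re ((t `^ nu)%:C * f t)) by [].
    by apply/funext => t; case: (f t) => x y /=; ring.
- apply: (tail (fun t => normc (f t)) I V (fun t => Im (f t))) => //.
  + move=> s t s1 st; rewrite (le_trans _ (fV s t s1 st))// -raddfB.
    exact: ler_Im_normc.
  + by move=> t; exact: ler_Im_normc.
  + suff -> : (fun t => t `^ nu * Im (f t)) = (fun t => Im ((t `^ nu)%:C * f t)) by [].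
    by apply/funext => t; case: (f t) => x y /=; ring.
Qed.

End hankel_uniform.

Theorem proposition3p3 (R : realType) (alpha nu mu : R) (f : R -> R[i])
  (halpha : - (1 / 2) <= alpha)
  (fBV : locally_bounded_variation_pos f)
  (fli : clocally_integrable `]0, +oo[ f)
  (fL1 : cintegrable `]0, 1[ (fun t => (t `^ nu)%:C * f t))
  (fdf : finite_variation_integral (fun t => t `^ (nu - alpha - 1 / 2)) f 1)
  (f0 : M `^ (nu - alpha - 1 / 2) * normc (f M) @[M --> +oo] --> (0 : R)) :
  (forall r : R, 0 < r -> hankel_converges alpha nu mu f r) /\
  (forall eps : R, 0 < eps ->
    [/\ 0 < mu + nu - alpha - 3 / 2 ->
          hankel_converges_uniformly alpha nu mu f `[0, eps],
        mu + nu - alpha - 3 / 2 < 0 ->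
          hankel_converges_uniformly alpha nu mu f `[eps, +oo[
      & mu + nu - alpha - 3 / 2 = 0 ->
          hankel_converges_uniformly alpha nu mu f `[0, +oo[ ]).
Proof.
have unif := hankel_uniform_on alpha nu mu f _ _ halpha fBV fli fL1 fdf f0.
split=> [r r0|eps eps0].
  (* Pointwise convergence is uniform convergence on a singleton, with the power of [r] as its own
     bound. *)
  have [|||cv _] := unif [set r] (r `^ (mu + nu - alpha - 3 / 2)).
  - by move=> _ ->; exact: ltW.
  - by move=> r0'; move: r0; rewrite -r0' ltxx.
  - by move=> _ ->.
  - exact: cv.
split=> kappa.
- apply: (unif _ (eps `^ (mu + nu - alpha - 3 / 2)) _ _ _).2.
  + by move=> r; rewrite /= in_itv/= => /andP[].
  (* Here mu + nu > alpha + 3/2 >= 1, so the factor at [r = 0] is 0. *)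
  + by move=> _; rewrite gt_eqF//; lra.
  + move=> r; rewrite /= in_itv/= => /andP[r0 re].
    by apply: ge0_ler_powR => //; [exact: ltW|exact: ltW].
- apply: (unif _ (eps `^ (mu + nu - alpha - 3 / 2)) _ _ _).2.
  + by move=> r; rewrite /= in_itv/= andbT; apply: le_trans; exact: ltW.
  + by rewrite /= in_itv/= andbT leNgt eps0.
  + move=> r; rewrite /= in_itv/= andbT => er.
    have r0 : 0 < r by exact: lt_le_trans eps0 er.
    (* A negative exponent is turned into the inverse of a positive power, which is largest at
       [eps]. *)
    rewrite -[X in _ `^ X <= _]opprK -[X in _ <= _ `^ X]opprK.
    rewrite !(powRN _ (- _)) lef_pV2 ?posrE ?powR_gt0//.
    by apply: ge0_ler_powR => //; rewrite ?oppr_ge0 ?nnegrE ltW.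
- apply: (unif _ 1 _ _ _).2.
  + by move=> r; rewrite /= in_itv/= andbT.
  + by move=> _; rewrite gt_eqF//; lra.
  + by move=> r _; rewrite kappa powRr0.
Qed.
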